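(* If $R=k[[x_1,\dots,x_n]]$, $\mathfrak{a}\subseteq R$ is any ideal, and $k$ is an $F$-finite field of characteristic $p>0$, then the $F$-jumping numbers of $\tau(R,\mathfrak{a}^t)$ are a discrete set of rational numbers.
   Context: $F$-finite means the Frobenius is a finite map (for a field, $[k:k^p]<\infty$). For real $t\geq 0$, the test ideal $\tau(R,\mathfrak{a}^t)$ is defined to be the unique smallest nonzero ideal $J\subseteq R$ such that $\phi(F^e_*(\mathfrak{a}^{\lceil t(p^e-1)\rceil}J))\subseteq J$ for every $e>0$ and every $\phi\in\operatorname{Hom}_R(F^e_*R,R)$, where $F^e$ is the $e$-iterated Frobenius and $F^e_*R$ is $R$ viewed as an $R$-module via $F^e$. A real number $t>0$ is an $F$-jumping number if $\tau(R,\mathfrak{a}^{t-\varepsilon})\neq\tau(R,\mathfrak{a}^t)$ for all $\varepsilon>0$ (with $t-\varepsilon\geq 0$, so that the test ideal on the left is defined). ''Discrete'' means having no limit points in $\mathbb{R}$. *)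

(* Defs.v *)
From HB Require Import structures.
From mathcomp Require Import all_boot all_order all_algebra.
From mathcomp Require Import boolp.
From mathcomp Require mpoly.

Set Implicit Arguments.
Unset Strict Implicit.
Unset Printing Implicit Defensive.

Import Order.TTheory GRing.Theory Num.Theory.

Local Open Scope ring_scope.

Module MPowerSeries.
Import mpoly.

(* k[[x_1, ..., x_n]]: a power series is the family of its coefficients,
   indexed by the exponent vectors 'X_{1..n}. *)
Record mpseries (n : nat) (k : Type) := MPSeries { mpscoef : 'X_{1..n} -> k }.

HB.instance Definition _ n k := [isNew for @mpscoef n k].
HB.instance Definition _ n (k : choiceType) := [Choice of mpseries n k by <:].

Section Ring.
Variables (n : nat) (k : comNzRingType).
Implicit Types f g h : mpseries n k.

Lemma mpseriesP f g : mpscoef f =1 mpscoef g -> f = g.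
Proof. by move=> /funext e; apply: val_inj. Qed.

Definition mps_zero : mpseries n k := MPSeries (fun=> 0).
Definition mps_opp f : mpseries n k := MPSeries (fun m => - mpscoef f m).
Definition mps_add f g : mpseries n k :=
  MPSeries (fun m => mpscoef f m + mpscoef g m).
Definition mps_one : mpseries n k := MPSeries (fun m => (m == 0%MM)%:R).
(* The degree bounds only make the index set finite: d.1 + d.2 = m already
   forces d.1 and d.2 to have degree at most mdeg m. *)
Definition mps_mul f g : mpseries n k := MPSeries (fun m =>
  \sum_(d : 'X_{1..n < (mdeg m).+1, (mdeg m).+1} | m == (d.1 + d.2)%MM)
    mpscoef f d.1 * mpscoef g d.2).

Fact mps_addA : associative mps_add.
Proof. by move=> f g h; apply: mpseriesP => m; rewrite /= addrA. Qed.
Fact mps_addC : commutative mps_add.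
Proof. by move=> f g; apply: mpseriesP => m; rewrite /= addrC. Qed.
Fact mps_add0 : left_id mps_zero mps_add.
Proof. by move=> f; apply: mpseriesP => m; rewrite /= add0r. Qed.
Fact mps_addN : left_inverse mps_zero mps_opp mps_add.
Proof. by move=> f; apply: mpseriesP => m; rewrite /= addNr. Qed.

HB.instance Definition _ := GRing.isZmodule.Build (mpseries n k)
  mps_addA mps_addC mps_add0 mps_addN.

(* The ring axioms are inherited from polynomials by truncation. *)
Definition mps_trunc b f : {mpoly k[n]} :=
  \sum_(m : 'X_{1..n < b}) mpscoef f m *: 'X_[m].

Lemma mcoeff_trunc b f m : (mdeg m < b)%N -> (mps_trunc b f)@_m = mpscoef f m.
Proof. exact: (mcoeff_mpoly (mpscoef f)). Qed.

Lemma mcoeffM_eq (P P' Q Q' : {mpoly k[n]}) m :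
    (forall d, (mdeg d <= mdeg m)%N -> P@_d = P'@_d) ->
    (forall d, (mdeg d <= mdeg m)%N -> Q@_d = Q'@_d) ->
  (P * Q)@_m = (P' * Q')@_m.
Proof.
move=> eP eQ; rewrite !mcoeffM; apply: eq_bigr => -[d1 d2] _ /=.
by rewrite eP ?eQ // -ltnS bmdeg.
Qed.

Lemma mpscoefM b f g m : (mdeg m < b)%N ->
  mpscoef (mps_mul f g) m = (mps_trunc b f * mps_trunc b g)@_m.
Proof.
move=> mb; rewrite mcoeffM /=; apply: eq_bigr => -[d1 d2] _ /=.
by rewrite !mcoeff_trunc // (leq_trans _ mb) // bmdeg.
Qed.

Lemma mcoeff_truncM b f g d : (mdeg d < b)%N ->
  (mps_trunc b (mps_mul f g))@_d = (mps_trunc b f * mps_trunc b g)@_d.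
Proof. by move=> db; rewrite mcoeff_trunc // (mpscoefM _ _ db). Qed.

Fact mps_mulA : associative mps_mul.
Proof.
move=> f g h; apply: mpseriesP => m.
pose b := (mdeg m).+1.
rewrite !(@mpscoefM b) //.
transitivity (mps_trunc b f * (mps_trunc b g * mps_trunc b h))@_m.
  by apply: mcoeffM_eq => d dm //; rewrite mcoeff_truncM.
rewrite mulrA; apply: mcoeffM_eq => d dm //.
by rewrite mcoeff_truncM.
Qed.

Fact mps_mulC : commutative mps_mul.
Proof.
move=> f g; apply: mpseriesP => m; pose b := (mdeg m).+1.
by rewrite !(@mpscoefM b) // [in RHS]mulrC.
Qed.

Fact mps_mul1 : left_id mps_one mps_mul.
Proof.
move=> f; apply: mpseriesP => m; rewrite (@mpscoefM (mdeg m).+1) //.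
transitivity (1 * mps_trunc (mdeg m).+1 f)@_m; last first.
  by rewrite mul1r mcoeff_trunc.
by apply: mcoeffM_eq => d dm //; rewrite mcoeff_trunc //= mcoeff1.
Qed.

Fact mps_mulDl : left_distributive mps_mul mps_add.
Proof.
move=> f g h; apply: mpseriesP => m /=; rewrite -big_split /=.
by apply: eq_bigr => d _; rewrite mulrDl.
Qed.

Fact mps_oner_neq0 : mps_one != 0 :> mpseries n k.
Proof.
apply/eqP => /(congr1 (fun f => mpscoef f 0%MM)) /=.
by rewrite eqxx; apply/eqP; rewrite oner_eq0.
Qed.

HB.instance Definition _ := GRing.Zmodule_isComNzRing.Build (mpseries n k)
  mps_mulA mps_mulC mps_mul1 mps_mulDl mps_oner_neq0.

Lemma mpscoefMn f j m : mpscoef (f *+ j) m = mpscoef f m *+ j.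
Proof. by elim: j => // j IH; rewrite !mulrS -IH. Qed.

Lemma pchar_mpseries p : p \in [pchar k] -> p \in [pchar mpseries n k].
Proof.
case/andP => p_pr /eqP p0; apply/andP; split=> //; apply/eqP.
apply: mpseriesP => m; rewrite mpscoefMn /=.
by rewrite -[LHS]mulr_natr p0 mulr0.
Qed.

End Ring.
End MPowerSeries.
Export MPowerSeries.

From mathcomp Require Import all_classical all_reals all_analysis.
Import numFieldNormedType.Exports.

Local Open Scope classical_set_scope.
Local Open Scope ring_scope.

Section Ideals.
Variable R : comNzRingType.
Implicit Types I J : set R.

Definition is_ideal I :=
  [/\ I 0, forall x y, I x -> I y -> I (x + y) & forall r x, I x -> I (r * x)].

Definition ideal_mul I J : set R := [set x | exists m (u v : 'I_m -> R),
  [/\ forall i, I (u i), forall i, J (v i) & x = \sum_i u i * v i]].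

Definition ideal_exp I (m : nat) : set R := iter m (ideal_mul I) setT.

End Ideals.

(* R is a finitely generated module over its subring of p-th powers. *)
Definition F_finite (p : nat) (R : comNzRingType) := exists m (b : 'I_m -> R),
  forall x : R, exists c : 'I_m -> R, x = \sum_i c i ^+ p * b i.

(* F^e_* R: the additive group R with scalars acting through F^e. *)
Definition Frob_push (R : comNzRingType) (p : nat) (charRp : p \in [pchar R])
  (e : nat) : Type := R.

Section FrobPush.
Variables (R : comNzRingType) (p : nat) (charRp : p \in [pchar R]) (e : nat).

HB.instance Definition _ := GRing.Zmodule.copy (Frob_push charRp e) R.

Definition Frob_push_scale (r : R) (x : Frob_push charRp e) :
  Frob_push charRp e := iter e (pFrobenius_aut charRp) r * (x : R).

Fact Frob_push_scaleA a b v :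
  Frob_push_scale a (Frob_push_scale b v) = Frob_push_scale (a * b) v.
Proof.
rewrite /Frob_push_scale mulrA; congr (_ * _).
by elim: e => //= j <-; rewrite rmorphM.
Qed.

Fact Frob_push_scale1 : left_id 1 Frob_push_scale.
Proof.
move=> v; rewrite /Frob_push_scale.
suff -> : iter e (pFrobenius_aut charRp) 1 = 1 by rewrite mul1r.
by elim: e => //= j ->; rewrite rmorph1.
Qed.

Fact Frob_push_scaleDr : right_distributive Frob_push_scale +%R.
Proof. by move=> a u v; exact: mulrDr. Qed.

Fact Frob_push_scaleDl v : {morph Frob_push_scale^~ v : a b / a + b}.
Proof.
move=> a b; rewrite /Frob_push_scale -[RHS]mulrDl; congr (_ * _).
by elim: e => //= j ->; rewrite rmorphD.
Qed.

HB.instance Definition _ := GRing.Zmodule_isLmodule.Build R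
  (Frob_push charRp e) Frob_push_scaleA Frob_push_scale1 Frob_push_scaleDr
  Frob_push_scaleDl.

End FrobPush.

Section TestIdeals.
Variables (K : realType) (R : comNzRingType) (p : nat).
Variable (charRp : p \in [pchar R]).
Implicit Types (a J : set R) (t : K).

(* `|_|%N only converts from int to nat: the argument is nonnegative for
   t >= 0. *)
Definition ceil_exp t (e : nat) : nat := `|Num.ceil (t * (p%:R ^+ e - 1))|%N.

Definition F_compatible a t J := forall e : nat, (0 < e)%N ->
  forall phi : {linear Frob_push charRp e -> R^o},
  phi @` ideal_mul (ideal_exp a (ceil_exp t e)) J `<=` J.

Definition candidate a t : set (set R) :=
  [set J | [/\ is_ideal J, J <> [set 0] & F_compatible a t J]].

Definition is_test_ideal a t J :=
  candidate a t J /\ forall J', candidate a t J' -> J `<=` J'.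

(* When there is no smallest candidate, the value is the zero ideal. For t >= 0
   and R = k[[x_1, ..., x_n]] with k an F-finite field, this only happens for
   a = 0, t > 0 and n > 0, and agrees with the convention tau(R, 0^t) = 0. *)
Definition test_ideal a t : set R := xget [set 0] (is_test_ideal a t).

Definition F_jumping_number a : set K := [set t | 0 < t /\
  forall eps, 0 < eps -> 0 <= t - eps ->
    test_ideal a (t - eps) <> test_ideal a t].

End TestIdeals.

(* Main.v *)
(* R is free over its subring of p-th powers; let C(I) = I^{[1/p]} be the ideal
   generated by the coordinates of the elements of I. Homomorphisms F^e_* R -> R
   are R-combinations of e-fold coordinates, and C^e(c R) = R for e large if
   c <> 0, so tau(a^t) is the union of the increasing chain C^e(a^{ceil(t p^e)}).
   Consequently tau is locally constant to the right, C(tau(a^t)) = tau(a^{t/p}),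
   and, if a has m generators, tau(a^t) = a tau(a^{t-1}) for t >= m (Skoda).

   If t > m and t (q - 1) = N is an integer, q = p^e, then the points
   s_{i+1} = (s_i + N) / q increase to t and tau(a^{s_{i+1}}) = C^e(a^N tau(a^{s_i})).
   A decreasing chain of this shape stabilizes, by the Hartshorne-Speiser-
   Lyubeznik-Gabber argument, so t is not a limit of jumping numbers.

   Jumping numbers are stable under multiplication by p and, above m + 1, under
   subtraction of 1, so x |-> p x mod 1 acts on the set L of their limit points
   in ]m, m + 1]. Right constancy makes L well-ordered and closed under suprema;
   its largest element that is minimal in its own orbit is periodic, hence of the
   form excluded above. So L is empty, which gives discreteness; then orbits of
   jumping numbers in ]m, m + 1] are finite, which gives rationality. *)
Require Import Defs.
From HB Require Import structures.
From mathcomp Require Import all_boot all_order all_algebra.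
From mathcomp Require Import boolp classical_sets ring.
From mathcomp Require mpoly.

Set Implicit Arguments.
Unset Strict Implicit.
Unset Printing Implicit Defensive.

Import Order.TTheory GRing.Theory Num.Theory.

Local Open Scope classical_set_scope.
Local Open Scope ring_scope.

(** * Ideals in noetherian rings *)

Section IdealTheory.
Variable R : comNzRingType.
Implicit Types (I J K : set R) (x y r : R).

Lemma is_ideal0 I : is_ideal I -> I 0.
Proof. by case. Qed.

Lemma is_idealD I x y : is_ideal I -> I x -> I y -> I (x + y).
Proof. by case=> _ + _; apply. Qed.

Lemma is_idealZ I r x : is_ideal I -> I x -> I (r * x).
Proof. by case=> _ _; apply. Qed.

Lemma is_idealB I x y : is_ideal I -> I x -> I y -> I (x - y).
Proof. by move=> iI Ix Iy; apply: is_idealD => //; rewrite -mulN1r; apply: is_idealZ. Qed.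

Lemma is_ideal_sum I (T : Type) (s : seq T) (P : pred T) (F : T -> R) :
  is_ideal I -> (forall i, P i -> I (F i)) -> I (\sum_(i <- s | P i) F i).
Proof.
move=> iI FI; apply: (big_ind I); [exact: is_ideal0| |exact: FI].
by move=> x y; apply: is_idealD.
Qed.

Lemma is_idealT : is_ideal [set: R].
Proof. by []. Qed.

Lemma is_idealI I J : is_ideal I -> is_ideal J -> is_ideal (I `&` J).
Proof.
move=> iI iJ; split; first by split; apply: is_ideal0.
  by move=> x y [? ?] [? ?]; split; apply: is_idealD.
by move=> r x [? ?]; split; apply: is_idealZ.
Qed.

Lemma is_ideal_colon I r : is_ideal I -> is_ideal [set x | I (r * x)].
Proof.
move=> iI; split; rewrite /= ?mulr0; first exact: is_ideal0.
  by move=> x y ? ?; rewrite mulrDr; apply: is_idealD.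
by move=> c x ?; rewrite mulrCA; apply: is_idealZ.
Qed.

Definition ideal_add I J : set R := [set z | exists x y, [/\ I x, J y & z = x + y]].

Lemma is_ideal_add I J : is_ideal I -> is_ideal J -> is_ideal (ideal_add I J).
Proof.
move=> iI iJ; split.
- by exists 0, 0; rewrite addr0; split=> //; apply: is_ideal0.
- move=> _ _ [x [y [Ix Jy ->]]] [x' [y' [Ix' Jy' ->]]].
  by exists (x + x'), (y + y'); rewrite addrACA; split=> //; apply: is_idealD.
- move=> r _ [x [y [Ix Jy ->]]]; exists (r * x), (r * y).
  by rewrite mulrDr; split=> //; apply: is_idealZ.
Qed.

Lemma ideal_mulW I J x y : I x -> J y -> ideal_mul I J (x * y).
Proof. by move=> Ix Jy; exists 1%N, (fun=> x), (fun=> y); rewrite big_ord1. Qed.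

Lemma is_ideal_mul I J : is_ideal I -> is_ideal (ideal_mul I J).
Proof.
move=> iI; split.
- by exists 0%N, (fun=> 0), (fun=> 0); rewrite big_ord0; split=> // -[].
- move=> _ _ [m [u [v [Iu Jv ->]]]] [m' [u' [v' [Iu' Jv' ->]]]].
  exists (m + m')%N, (fun i => match split i with inl j => u j | inr j => u' j end),
   (fun i => match split i with inl j => v j | inr j => v' j end).
  split; try by move=> i; case: split.
  rewrite big_split_ord /=; congr (_ + _); apply: eq_bigr => i _.
    by rewrite (unsplitK (inl _ i)).
  by rewrite (unsplitK (inr _ i)).
- move=> r _ [m [u [v [Iu Jv ->]]]]; exists m, (fun i => r * u i), v.
  split=> // [i|]; first exact: is_idealZ.
  by rewrite mulr_sumr; apply: eq_bigr => i _; rewrite mulrA.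
Qed.

Lemma ideal_mul_min I J K : is_ideal K ->
  (forall x y, I x -> J y -> K (x * y)) -> ideal_mul I J `<=` K.
Proof.
move=> iK h _ [m [u [v [Iu Jv ->]]]]; apply: is_ideal_sum => // i _; exact: h.
Qed.

Lemma ideal_mulS I J J' : J `<=` J' -> ideal_mul I J `<=` ideal_mul I J'.
Proof. by move=> h x [m [u [v [Iu Jv ->]]]]; exists m, u, v; split=> // i; apply: h. Qed.

Lemma is_ideal_exp I N : is_ideal I -> is_ideal (ideal_exp I N).
Proof. by move=> iI; case: N => [|N]; [exact: is_idealT|apply: is_ideal_mul]. Qed.

Lemma ideal_expD I M N x y : is_ideal I ->
  ideal_exp I M x -> ideal_exp I N y -> ideal_exp I (M + N) (x * y).
Proof.
move=> iI; elim: M x => [|M IH] x; first by move=> _ Iy; apply: is_idealZ => //; apply: is_ideal_exp.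
rewrite addSn => + Iy; move: x; apply: (@ideal_mul_min _ _ [set x | ideal_exp I (M + N).+1 (x * y)]).
  by under eq_fun do rewrite mulrC; apply/is_ideal_colon/is_ideal_exp.
by move=> u v Iu Iv /=; rewrite -mulrA; apply: ideal_mulW => //; apply: IH.
Qed.

Lemma ideal_exp_le I M N : is_ideal I -> (M <= N)%N -> ideal_exp I N `<=` ideal_exp I M.
Proof.
move=> iI; elim: N M => [|N IH] [|M] //.
by rewrite ltnS => MN; apply: ideal_mulS; apply: IH.
Qed.

Lemma ideal_expX I x N : is_ideal I -> I x -> ideal_exp I N (x ^+ N).
Proof. by move=> iI Ix; elim: N => [//|N IH]; rewrite exprS; apply: ideal_mulW. Qed.

Lemma ideal_expM I x M N : is_ideal I -> ideal_exp I M x -> ideal_exp I (M * N) (x ^+ N).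
Proof.
move=> iI Ix; elim: N => [|N IH]; first by rewrite muln0.
by rewrite mulnS exprS; apply: ideal_expD.
Qed.

Lemma iter_ideal_mulS I N J J' : J `<=` J' ->
  iter N (ideal_mul I) J `<=` iter N (ideal_mul I) J'.
Proof. by move=> h; elim: N => //= N IH; apply: ideal_mulS. Qed.

Lemma is_ideal_iter_mul I N J : is_ideal I -> is_ideal J -> is_ideal (iter N (ideal_mul I) J).
Proof. by move=> iI iJ; case: N => [//|N]; apply: is_ideal_mul. Qed.

Lemma iter_ideal_mul_scale I N J J' r : (forall x, J x -> J' (r * x)) ->
  forall x, iter N (ideal_mul I) J x -> iter N (ideal_mul I) J' (r * x).
Proof.
move=> h; elim: N => //= N IH _ [m [u [v [Iu Jv ->]]]].
exists m, u, (fun i => r * v i); split=> // [i|]; first exact: IH.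
by rewrite mulr_sumr; apply: eq_bigr => i _; rewrite mulrCA.
Qed.

(** The iterated product is I^N J bracketed to the right; induction through the colon ideals (K : x)
    regroups it. *)
Lemma iter_ideal_mul_min I N J K : is_ideal I -> is_ideal K ->
  (forall x y, ideal_exp I N x -> J y -> K (x * y)) -> iter N (ideal_mul I) J `<=` K.
Proof.
move=> iI iK; elim: N K iK => [|N IH] K iK h x /=.
  by move=> Jx; rewrite -[x]mul1r; apply: h.
move: x; apply: ideal_mul_min => // x y Ix.
apply: (IH [set y | K (x * y)]); first exact: is_ideal_colon.
by move=> z t Iz Jt /=; rewrite mulrA; apply: h => //; apply: ideal_mulW.
Qed.

Definition ideal_gen m (f : 'I_m -> R) : set R :=
  [set x | exists c : 'I_m -> R, x = \sum_i c i * f i].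

Lemma ideal_gen_mem m (f : 'I_m -> R) i : ideal_gen f (f i).
Proof.
exists (fun j => (j == i)%:R); rewrite (bigD1 i) //= eqxx mul1r big1 ?addr0 //.
by move=> j /negbTE ->; rewrite mul0r.
Qed.

Lemma is_ideal_gen m (f : 'I_m -> R) : is_ideal (ideal_gen f).
Proof.
split.
- by exists (fun=> 0); rewrite big1 // => i _; rewrite mul0r.
- move=> _ _ [c ->] [d ->]; exists (fun i => c i + d i).
  by rewrite -big_split; apply: eq_bigr => i _; rewrite mulrDl.
- move=> r _ [c ->]; exists (fun i => r * c i).
  by rewrite mulr_sumr; apply: eq_bigr => i _; rewrite mulrA.
Qed.

Lemma ideal_gen_min m (f : 'I_m -> R) K :
  is_ideal K -> (forall i, K (f i)) -> ideal_gen f `<=` K.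
Proof. by move=> iK fK _ [c ->]; apply: is_ideal_sum => // i _; apply: is_idealZ. Qed.

(** [K] varies in the induction: splitting off one factor [f i] replaces it by (K : f i). *)
Lemma ideal_exp_gen_min m (f : 'I_m -> R) N K : is_ideal K ->
    (forall d : 'I_m -> nat, (\sum_i d i = N)%N -> K (\prod_i f i ^+ d i)) ->
  ideal_exp (ideal_gen f) N `<=` K.
Proof.
elim: N K => [|N IH] K iK h x.
  move=> _; rewrite -[x]mulr1; apply: is_idealZ => //.
  have <- : \prod_(i < m) f i ^+ 0 = 1 by rewrite big1.
  by apply: (h (fun=> 0%N)); rewrite big1.
move: x; apply: ideal_mul_min => // _ y [c ->] yN.
rewrite mulr_suml; apply: is_ideal_sum => // i _; rewrite -mulrA; apply: is_idealZ => //.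
move: y yN; apply: (IH [set y | K (f i * y)]); first exact: is_ideal_colon.
move=> d dN /=.
have -> : f i * \prod_j f j ^+ d j = \prod_j f j ^+ ((j == i) + d j).
  under [RHS]eq_bigr do rewrite exprD; rewrite big_split /=; congr (_ * _).
  by rewrite (bigD1 i) //= eqxx big1 ?mulr1 // => j /negbTE ->.
apply: h; rewrite big_split /= dN -[RHS]add1n; congr (_ + _)%N.
by rewrite (bigD1 i) //= eqxx big1 ?addn0 // => j /negbTE ->.
Qed.

Lemma ideal_exp_prod m (f : 'I_m -> R) I (d : 'I_m -> nat) : is_ideal I ->
  (forall i, I (f i)) -> ideal_exp I (\sum_i d i) (\prod_i f i ^+ d i).
Proof.
move=> iI fI; apply: (big_ind2 (fun N x => ideal_exp I N x)) => //.
  by move=> x M y N; apply: ideal_expD.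
by move=> i _; apply: ideal_expX.
Qed.

(* Pigeonhole: a monomial of degree > m (q - 1) in m generators is divisible
   by the q-th power of one of them. *)
Lemma ideal_exp_pigeonhole m (f : 'I_m -> R) q N x : (m * q.-1 < N)%N ->
  ideal_exp (ideal_gen f) N x ->
  exists z : 'I_m -> R, (forall i, ideal_exp (ideal_gen f) (N - q) (z i)) /\
    x = \sum_i f i ^+ q * z i.
Proof.
move=> mqN; pose I := ideal_gen f; have iI : is_ideal I := is_ideal_gen f.
have iE := is_ideal_exp (N - q) iI.
move: x; apply: ideal_exp_gen_min => [|d dN].
  split.
  - by exists (fun=> 0); split=> [i|]; [apply: is_ideal0|rewrite big1 // => i _; rewrite mulr0].
  - move=> _ _ [z [Iz ->]] [t [It ->]]; exists (fun i => z i + t i); split=> [i|].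
      by apply: is_idealD.
    by rewrite -big_split; apply: eq_bigr => i _; rewrite mulrDr.
  - move=> r _ [z [Iz ->]]; exists (fun i => r * z i); split=> [i|].
      by apply: is_idealZ.
    by rewrite mulr_sumr; apply: eq_bigr => i _; rewrite mulrCA.
have [i qi] : exists i, (q <= d i)%N.
  apply: contrapT => /forallNP h; move: mqN; rewrite -dN ltnNge.
  rewrite -[m in (m * _)%N]card_ord -sum_nat_const leq_sum // => i _.
  by move: (h i); case: q {iE h} => [/(_ isT) //|q] /negP; rewrite -ltnNge ltnS.
exists (fun j => if j == i then \prod_l f l ^+ (d l - (l == i) * q) else 0); split.
  move=> j; case: eqP => // _; last exact: is_ideal0.
  have <- : (\sum_l (d l - (l == i) * q) = N - q)%N.
    rewrite -dN (bigD1 i) //= eqxx mul1n [in RHS](bigD1 i) //= -addnBAC //; congr (_ + _)%N.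
    by apply: eq_bigr => l /negbTE ->; rewrite subn0.
  by apply: ideal_exp_prod => // l; apply: ideal_gen_mem.
rewrite [RHS](bigD1 i) //= eqxx [X in _ + X]big1 ?addr0; last by move=> j /negbTE ->; rewrite mulr0.
rewrite (bigD1 i) //= [in RHS](bigD1 i) //= mulrA eqxx mul1n -exprD subnKC //; congr (_ * _).
by apply: eq_bigr => l /negbTE ->; rewrite subn0.
Qed.

Definition noetherian := forall I, is_ideal I ->
  exists m (f : 'I_m -> R), I = ideal_gen f.

Lemma noetherian_acc (I_ : nat -> set R) : noetherian ->
    (forall i, is_ideal (I_ i)) -> (forall i, I_ i `<=` I_ i.+1) ->
  exists i, forall j, (i <= j)%N -> I_ j = I_ i.
Proof.
move=> nR iI sI.
have mI i j : (i <= j)%N -> I_ i `<=` I_ j.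
  elim: j => [|j IH]; first by rewrite leqn0 => /eqP ->.
  by rewrite leq_eqVlt => /predU1P[-> //|/IH]; move/subset_trans; apply.
have iU : is_ideal (\bigcup_i I_ i).
  split; first by exists 0%N => //; apply: is_ideal0.
    move=> x y [i _ Ix] [j _ Iy]; exists (maxn i j) => //.
    by apply: is_idealD => //; [apply: mI Ix; apply: leq_maxl|apply: mI Iy; apply: leq_maxr].
  by move=> r x [i _ Ix]; exists i => //; apply: is_idealZ.
have [m [f Uf]] := nR _ iU.
have /choice[k kP] : forall l, exists i, I_ i (f l).
  move=> l; have [i _] : (\bigcup_i I_ i) (f l) by rewrite Uf; apply: ideal_gen_mem.
  by exists i.
exists (\max_l k l)%N => j kj; apply/seteqP; split; last exact: mI.
apply: (@subset_trans _ (\bigcup_i I_ i)); first by move=> x Ix; exists j.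
rewrite Uf; apply: ideal_gen_min => // l; apply: mI (kP l); exact: leq_bigmax.
Qed.

Lemma noetherian_max (F : set (set R)) I0 : noetherian ->
  (forall I, F I -> is_ideal I) -> F I0 ->
  exists2 M, F M & forall N, F N -> M `<=` N -> N = M.
Proof.
move=> nR iF FI0; apply: contrapT => /forall2NP h.
have /choice[s sP] : forall M : {M | F M}, exists N : {M | F M},
    sval M `<=` sval N /\ sval N <> sval M.
  move=> [M FM]; have [//|] := h M.
  move=> /existsNP[N /not_implyP[FN /not_implyP[MN NM]]].
  by exists (exist _ N FN).
pose I_ i := sval (iter i s (exist _ I0 FI0)).
have [|i|i iP] := @noetherian_acc I_ nR.
- by move=> i; apply: iF; apply: svalP.
- by have [] := sP (iter i s (exist _ I0 FI0)).
- by have [_] := sP (iter i s (exist _ I0 FI0)); apply; apply: (iP i.+1).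
Qed.

End IdealTheory.

(** * Descending chains of ideals after localization at a prime *)

Section DescendingChains.
Variable R : comNzRingType.
Implicit Types (I J K P X Y Z : set R) (r s x : R).

(* Descending chain condition after localizing at the prime P. *)
Definition local_dcc P X Y := forall I_ : nat -> set R,
  (forall i, is_ideal (I_ i)) -> (forall i, I_ i.+1 `<=` I_ i) ->
  (forall i, Y `<=` I_ i) -> (forall i, I_ i `<=` X) ->
  exists i, forall j, (i <= j)%N ->
    exists2 s, ~ P s & forall x, I_ j x -> I_ j.+1 (s * x).

Lemma local_dccS P X Y Y' : Y `<=` Y' -> local_dcc P X Y -> local_dcc P X Y'.
Proof. by move=> YY' h I_ iI sI YI; apply: h => // i; apply: subset_trans (YI i). Qed.

Definition prime_ideal P :=
  [/\ is_ideal P, ~ P 1 & forall x y, P (x * y) -> P x \/ P y].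

(** Additivity of finite length: a chain leaves traces I + Y on X/Y and I ∩ Y on Y/Z, and the
    product of the two denominators serves the chain itself. *)
Lemma local_dcc_trans P X Y Z : prime_ideal P -> is_ideal Y -> is_ideal X ->
  Y `<=` X -> Z `<=` Y -> local_dcc P X Y -> local_dcc P Y Z -> local_dcc P X Z.
Proof.
move=> [_ _ pP] iY iX YX ZY dXY dYZ I_ iI sI ZI IX.
have [||||i1 h1] := dXY (fun i => ideal_add (I_ i) Y).
- by move=> i; apply: is_ideal_add.
- by move=> i _ [x [y [Ix Yy ->]]]; exists x, y; split=> //; apply: sI.
- by move=> i y Yy; exists 0, y; rewrite add0r; split=> //; apply: is_ideal0.
- by move=> i _ [x [y [Ix Yy ->]]]; apply: is_idealD => //; [apply: IX Ix|apply: YX].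
have [||||i2 h2] := dYZ (fun i => I_ i `&` Y).
- by move=> i; apply: is_idealI.
- by move=> i x [Ix Yx]; split=> //; apply: sI.
- by move=> i x Zx; split; [apply: ZI|apply: ZY].
- by move=> i x [].
exists (maxn i1 i2) => j; rewrite geq_max => /andP[/h1[s Ps s1] /h2[t Pt t2]].
exists (t * s) => [/pP[]//|x Ix].
have [|u [v [Iu Yv suv]]] := s1 x.
  by exists x, 0; rewrite addr0; split=> //; apply: is_ideal0.
have [|Itv _] := t2 v; first split=> //.
  have -> : v = s * x - u by rewrite suv addrC addKr.
  by apply: is_idealB => //; [apply: is_idealZ|apply: sI].
by rewrite -mulrA suv mulrDr; apply: is_idealD => //; apply: is_idealZ.
Qed.

Lemma local_dcc_torsion P X Y s : is_ideal Y -> ~ P s ->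
  (forall x, X x -> Y (s * x)) -> local_dcc P X Y.
Proof.
move=> iY Ps h I_ iI sI YI IX; exists 0%N => j _; exists s => // x /IX /h; exact: YI.
Qed.

Definition ideal_adj Y g : set R := [set z | exists2 c, Y c & exists r, z = c + r * g].

Lemma ideal_adjS Y g : Y `<=` ideal_adj Y g.
Proof. by move=> y Yy; exists y => //; exists 0; rewrite mul0r addr0. Qed.

Lemma ideal_adj_mem Y g : is_ideal Y -> ideal_adj Y g g.
Proof. by move=> iY; exists 0; [apply: is_ideal0|exists 1; rewrite mul1r add0r]. Qed.

Lemma is_ideal_adj Y g : is_ideal Y -> is_ideal (ideal_adj Y g).
Proof.
move=> iY; split.
- by apply: ideal_adjS; apply: is_ideal0.
- move=> _ _ [c Yc [r ->]] [c' Yc' [r' ->]]; exists (c + c'); first exact: is_idealD.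
  by exists (r + r'); rewrite mulrDl addrACA.
- move=> s _ [c Yc [r ->]]; exists (s * c); first exact: is_idealZ.
  by exists (s * r); rewrite mulrDr mulrA.
Qed.

Lemma ideal_adj_min Y g K : is_ideal K -> Y `<=` K -> K g -> ideal_adj Y g `<=` K.
Proof.
by move=> iK YK Kg _ [c Yc [r ->]]; apply: is_idealD; [|apply: YK|apply: is_idealZ].
Qed.

(** (Y + Rg)/Y is a quotient of R/P, so at P it is zero or the residue field. Either the chain falls
    into Y, or each term contains some s g with s outside P, and s carries all of Y + Rg into that
    term. *)
Lemma local_dcc_adj P Y g : prime_ideal P -> is_ideal Y ->
  (forall h, P h -> Y (h * g)) -> local_dcc P (ideal_adj Y g) Y.
Proof.
move=> [iP P1 _] iY PgY I_ iI sI YI IX.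
have [[i h]|/forallNP h] := pselect (exists i, I_ i `<=` Y).
  exists i => j ij; exists 1 => // x Ix; rewrite mul1r; apply: YI; apply: h.
  elim: j ij x Ix => [|j IH]; first by rewrite leqn0 => /eqP -> x.
  rewrite leq_eqVlt => /predU1P[-> //|ij] x /sI; exact: IH.
exists 0%N => j _.
have /existsNP[x /not_implyP[Ix NYx]] := h j.+1.
have [c Yc [s xE]] := IX _ _ Ix.
have Ps : ~ P s by move=> /PgY Ysg; apply: NYx; rewrite xE; apply: is_idealD.
have Isg : I_ j.+1 (s * g).
  have -> : s * g = x - c by rewrite xE addrAC subrr add0r.
  by apply: is_idealB => //; apply: YI.
exists s => // y /IX[d Yd [r ->]]; rewrite mulrDr mulrCA.
by apply: is_idealD => //; [apply: YI|]; apply: is_idealZ.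
Qed.

Lemma local_dcc_refl P X : ~ P 1 -> local_dcc P X X.
Proof.
move=> P1 I_ iI sI YI IX; exists 0%N => j _; exists 1 => // x /IX; rewrite mul1r; exact: YI.
Qed.

(** X/PX is finitely generated over R/P; the generators of X are adjoined to PX one at a time. *)
Lemma local_dcc_mul P X : noetherian R -> prime_ideal P -> is_ideal X ->
  local_dcc P X (ideal_mul P X).
Proof.
move=> nR pP iX; have [iP P1 _] := pP; pose Y := ideal_mul P X.
have iY : is_ideal Y by apply: is_ideal_mul.
have YX : Y `<=` X by apply: ideal_mul_min => // x y _; apply: is_idealZ.
have [m [f Xf]] := nR _ iX.
have fX i : X (f i) by rewrite Xf; apply: ideal_gen_mem.
suff [Z [iZ YZ ZX dZ Zf]] : exists Z, [/\ is_ideal Z, Y `<=` Z, Z `<=` X, local_dcc P Z Y &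
    forall i, i \in enum 'I_m -> Z (f i)].
  suff XZ : X = Z by rewrite {1}XZ.
  apply/seteqP; split=> //; rewrite Xf; apply: ideal_gen_min => // i.
  by apply: Zf; rewrite mem_enum.
elim: (enum 'I_m) => [|i s [Z [iZ YZ ZX dZ Zs]]].
  by exists Y; split=> //; apply: local_dcc_refl.
exists (ideal_adj Z (f i)); split.
- exact: is_ideal_adj.
- exact: subset_trans (@ideal_adjS _ _).
- exact: ideal_adj_min.
- apply: (@local_dcc_trans _ _ Z) => //; [exact: is_ideal_adj|exact: ideal_adjS|].
  by apply: local_dcc_adj => // h Ph; apply: YZ; apply: ideal_mulW.
- move=> j; rewrite inE => /predU1P[->|/Zs]; first exact: ideal_adj_mem.
  exact: ideal_adjS.
Qed.

Lemma local_dcc_iter_mul P X k : noetherian R -> prime_ideal P -> is_ideal X ->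
  local_dcc P X (iter k (ideal_mul P) X).
Proof.
move=> nR pP iX; have [iP P1 _] := pP.
have iPX j : is_ideal (iter j (ideal_mul P) X) by apply: is_ideal_iter_mul.
have sub j : iter j.+1 (ideal_mul P) X `<=` iter j (ideal_mul P) X.
  by apply: ideal_mul_min => // x y _; apply: is_idealZ.
elim: k => [|k IH]; first exact: local_dcc_refl.
apply: local_dcc_trans IH _ => //; last exact: local_dcc_mul.
by elim: k => // k IH; apply: subset_trans (sub k) IH.
Qed.

(* Hartshorne-Speiser-Lyubeznik-Gabber stabilization. The ideals
   A_i = (M_{i+1} : M_i) increase and their union A is radical; if A were proper,
   localizing at an associated prime P = (A : s) would make M_i / M_{i+1}
   a nonzero subquotient, for every large i, of a module of finite length. *)
Lemma chain_stabilizes (Phi : set R -> set R) q (M : nat -> set R) :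
    noetherian R -> (1 < q)%N -> (forall I J, I `<=` J -> Phi I `<=` Phi J) ->
    (forall g I J, (forall x, I x -> J (g ^+ q * x)) ->
      forall y, Phi I y -> Phi J (g * y)) ->
    (forall i, is_ideal (M i)) -> (forall i, M i.+1 = Phi (M i)) ->
    (forall i, M i.+1 `<=` M i) ->
  exists i, forall j, (i <= j)%N -> M j = M i.
Proof.
move=> nR q1 PhiS PhiZ iM MS sM.
pose A_ i : set R := [set g | forall x, M i x -> M i.+1 (g * x)].
have iA i : is_ideal (A_ i).
  split; first by move=> x _; rewrite mul0r; apply: is_ideal0.
    by move=> g h gA hA x Mx; rewrite mulrDl; apply: is_idealD; [|apply: gA|apply: hA].
  by move=> r g gA x Mx; rewrite -mulrA; apply: is_idealZ => //; apply: gA.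
have A_next g i : (forall x, M i x -> M i.+1 (g ^+ q * x)) -> A_ i.+1 g.
  by move=> h x; rewrite [M i.+1]MS [M i.+2]MS; apply: PhiZ.
have sA i : A_ i `<=` A_ i.+1.
  move=> g gA; apply: A_next => x /gA.
  by rewrite -(ltn_predK q1) exprSr -mulrA; apply: is_idealZ.
have [i0 i0P] := noetherian_acc nR iA sA; pose A := A_ i0.
have AE i : (i0 <= i)%N -> A_ i = A by exact: i0P.
have iA0 : is_ideal A by exact: iA.
clearbody A.
have [A1|A1] := pselect (A 1).
  exists i0; elim=> [|j IH]; first by rewrite leqn0 => /eqP ->.
  rewrite leq_eqVlt => /predU1P[-> //|]; rewrite ltnS => ij; rewrite -IH //.
  apply/seteqP; split=> // x Mx; rewrite -[x]mul1r.
  have Aj : A_ j 1 by rewrite AE.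
  exact: Aj.
exfalso.
have radA g : A (g ^+ q) -> A g 
  by rewrite -{1}(AE i0) // -(AE i0.+1) // => gA; apply: A_next.
(* Annihilators of nonzero elements of R/A; a maximal one is an associated prime. *)
pose F := [set J : set R | exists2 s, ~ A s & J = [set x | A (s * x)]].
have [||P [s As PE] Pmax] := @noetherian_max R F A nR.
- by move=> _ [s _ ->]; apply: is_ideal_colon.
- by exists 1 => //; apply/seteqP; split=> x /=; rewrite mul1r.
have AP : A `<=` P by move=> x Ax; rewrite PE /=; apply: is_idealZ.
(* Otherwise s^2, hence s^q, would lie in A, and so would s by radicality. *)
have Ps : ~ P s.
  rewrite PE /= => Ass; apply: As; apply: radA.
  by rewrite -(subnKC q1) exprD mulrC expr2; apply: is_idealZ.
have pP : prime_ideal P.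
  split; first by rewrite PE; apply: is_ideal_colon.
    by rewrite PE /= mulr1.
  move=> x y Pxy; have [Px|Px] := pselect (P x); [by left|right].
  rewrite -(Pmax [set y | A (s * x * y)]) /=; first by move: Pxy; rewrite PE /= mulrA.
    by exists (s * x) => // Asx; apply: Px; rewrite PE /=.
  by rewrite PE => z /= Asz; rewrite mulrAC mulrC; apply: is_idealZ.
have [iP P1 primeP] := pP.
(* Write g^2 x = g (g x) with g x in [Phi (M i0)]. By induction g^q = g^(q-2) g^2 maps [M i0] into
   [M (i0 + j)], and [PhiZ] trades g^q for g. *)
have killA g : A g -> forall j x, M i0 x -> M (i0 + j)%N (g ^+ 2 * x).
  rewrite -(AE i0) // => gA; elim=> [|j IH] x Mx; first by rewrite addn0; apply: is_idealZ.
  rewrite addnS MS expr2 -mulrA; have := gA x Mx; rewrite MS; apply: PhiZ => z Mz.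
  by rewrite -(subnK q1) exprD -mulrA; apply: is_idealZ => //; apply: IH.
pose N := \bigcap_j M (i0 + j)%N.
have iN : is_ideal N.
  split; first by move=> j _; apply: is_ideal0.
    by move=> x y Nx Ny j _; apply: is_idealD => //; [apply: Nx|apply: Ny].
  by move=> r x Nx j _; apply: is_idealZ => //; apply: Nx.
have [m [f Pf]] := nR _ iP.
have fP i : P (f i) by rewrite Pf; apply: ideal_gen_mem.
(* As m + 1 > m (2 - 1), the pigeonhole lemma with q = 2 writes P^(m+1) in terms of the squares
   f_i^2. Each s f_i lies in A, so [killA] sends s^2 X into N. *)
pose X := iter m.+1 (ideal_mul P) (M i0).
have iX : is_ideal X by apply: is_ideal_iter_mul.
have XM : X `<=` M i0 by apply: iter_ideal_mul_min => // x y _; apply: is_idealZ.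
have sXN x : X x -> N (s ^+ 2 * x).
  move: x; apply: (@iter_ideal_mul_min _ _ _ _ [set x | N (s ^+ 2 * x)]) => //.
    exact: is_ideal_colon.
  move=> x y; rewrite {1}Pf => /(@ideal_exp_pigeonhole _ _ _ 2); rewrite muln1 => /(_ (leqnn _)).
  move=> [z [_ ->]] My /=; rewrite mulr_suml mulr_sumr.
  apply: is_ideal_sum => // i _.
  have -> : s ^+ 2 * (f i ^+ 2 * z i * y) = z i * ((s * f i) ^+ 2 * y).
    by ring.
  apply: (is_idealZ _ iN) => j _; apply: killA => //.
  by have := fP i; rewrite PE.
(* [M i0] / X has finite length at P, and X / s^2 X is killed by s^2, which is outside P. *)
have dM : local_dcc P (M i0) N.
  have NsX : [set z | exists2 x, X x & z = s ^+ 2 * x] `<=` N by move=> _ [x /sXN Nx ->].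
  apply: local_dccS NsX _; apply: (@local_dcc_trans _ _ X) => //.
  - by move=> _ [x Xx ->]; apply: is_idealZ.
  - exact: local_dcc_iter_mul.
  - apply: (@local_dcc_torsion _ _ _ (s ^+ 2)).
    + split; first by exists 0; [apply: is_ideal0|rewrite mulr0].
        by move=> _ _ [x Xx ->] [y Xy ->]; exists (x + y); [apply: is_idealD|rewrite mulrDr].
      by move=> r _ [x Xx ->]; exists (r * x); [apply: is_idealZ|rewrite mulrCA].
    + by rewrite expr2 => /primeP[].
    + by move=> x Xx; exists x.
(* Local stabilization yields t outside P that maps one term of the chain into the next, so t is in
   A, contrary to A inside P. *)
have [||||i /(_ i (leqnn _))[t Pt tM]] := dM (fun j => M (i0 + j)%N) => //.
- by move=> i /=; rewrite addnS.
- by move=> i x; apply.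
- by elim=> [|i IH] /=; rewrite ?addn0 // addnS; apply: subset_trans IH.
apply: Pt; apply: AP; rewrite -(AE (i0 + i)%N) ?leq_addr // => x /tM.
by rewrite addnS.
Qed.

End DescendingChains.

(** * Cartier operators *)

(** A dual basis of F_* R: the coordinate maps are stored as data, as members of Hom_R(F_* R, R). *)
Record Frob_basis (R : comNzRingType) (p : nat) := FrobBasis {
  fb_idx : finType;
  fb_elt : fb_idx -> R;
  fb_coord : fb_idx -> R -> R;
  fb_coordD : forall i, {morph fb_coord i : x y / x + y};
  fb_coordZ : forall i r x, fb_coord i (r ^+ p * x) = r * fb_coord i x;
  fb_coordE : forall x, x = \sum_i fb_coord i x ^+ p * fb_elt i
}.

Section CartierOperators.
Variables (R : comNzRingType) (p : nat) (charRp : p \in [pchar R]) (B : Frob_basis R p).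
Implicit Types (I J X Z : set R) (r x g : R).

Let p_gt0 : (0 < p)%N := prime_gt0 (pcharf_prime charRp).

Lemma fb_coord0 (i : fb_idx B) : fb_coord i 0 = 0.
Proof. by apply: (addrI (fb_coord i 0)); rewrite -fb_coordD !addr0. Qed.

Lemma fb_coord_sum (i : fb_idx B) (T : Type) (s : seq T) (P : pred T) (F : T -> R) :
  fb_coord i (\sum_(j <- s | P j) F j) = \sum_(j <- s | P j) fb_coord i (F j).
Proof. exact: (big_morph _ (@fb_coordD _ _ _ i) (fb_coord0 i)). Qed.

(* The ideal I^{[1/p]}. *)
Definition cart I : set R :=
  [set y | exists x : fb_idx B -> R, (forall i, I (x i)) /\ y = \sum_i @fb_coord _ _ B i (x i)].

Lemma cartS I J : I `<=` J -> cart I `<=` cart J.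
Proof. by move=> IJ _ [x [Ix ->]]; exists x; split=> // i; apply: IJ. Qed.

Lemma iter_cartS e I J : I `<=` J -> iter e cart I `<=` iter e cart J.
Proof. by move=> IJ; elim: e => //= e IH; apply: cartS. Qed.

(** Coordinates are p^{-1}-linear, so g^p leaves [cart] as g. The form with two ideals iterates, and
    provides the scaling hypothesis of [chain_stabilizes]. *)
Lemma cart_scale g I J : (forall x, I x -> J (g ^+ p * x)) ->
  forall y, cart I y -> cart J (g * y).
Proof.
move=> h _ [x [Ix ->]]; exists (fun i => g ^+ p * x i); split=> [i|]; first exact: h.
by rewrite mulr_sumr; apply: eq_bigr => i _; rewrite fb_coordZ.
Qed.

Lemma iter_cart_scale e g I J : (forall x, I x -> J (g ^+ (p ^ e) * x)) ->
  forall y, iter e cart I y -> iter e cart J (g * y).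
Proof.
elim: e g => [|e IH] g h; first by move=> y /h; rewrite expr1.
by apply: cart_scale; apply: IH => x; rewrite -exprM -expnS; apply: h.
Qed.

Lemma is_ideal_cart I : is_ideal I -> is_ideal (cart I).
Proof.
move=> iI; split.
- exists (fun=> 0); split=> [i|]; first exact: is_ideal0.
  by rewrite big1 // => i _; rewrite fb_coord0.
- move=> _ _ [x [Ix ->]] [y [Iy ->]]; exists (fun i => x i + y i).
  split=> [i|]; first exact: is_idealD.
  by rewrite -big_split; apply: eq_bigr => i _; rewrite fb_coordD.
- by move=> r x; apply: cart_scale => {}x; apply: is_idealZ.
Qed.

Lemma is_ideal_iter_cart e I : is_ideal I -> is_ideal (iter e cart I).
Proof. by move=> iI; elim: e => //= e IH; apply: is_ideal_cart. Qed.

Lemma cart_coord I i x : I 0 -> I x -> cart I (@fb_coord _ _ B i x).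
Proof.
move=> I0 Ix; exists (fun j => if j == i then x else 0); split=> [j|]; first by case: eqP.
rewrite (bigD1 i) //= eqxx big1 ?addr0 // => j /negbTE ->; exact: fb_coord0.
Qed.

Lemma sub_cart I : is_ideal I -> I `<=` cart I.
Proof.
move=> iI x Ix; rewrite [x](fb_coordE B); apply: is_ideal_sum => [|i _].
  exact: is_ideal_cart.
have xp (y : R) : y ^+ p = y ^+ p.-1 * y by rewrite -exprSr prednK.
rewrite mulrC xp mulrA; apply: is_idealZ; first exact: is_ideal_cart.
by apply: cart_coord => //; apply: is_ideal0.
Qed.

Lemma sub_iter_cart e d I : is_ideal I -> (e <= d)%N -> iter e cart I `<=` iter d cart I.
Proof.
move=> iI; elim: d => [|d IH]; first by rewrite leqn0 => /eqP ->.
rewrite leq_eqVlt => /predU1P[-> //|/IH /subset_trans]; apply.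
by apply: sub_cart; apply: is_ideal_iter_cart.
Qed.

(** Additivity and p^{-1}-linearity pull the f_i out of C^e term by term; Skoda's theorem uses this
    after the pigeonhole lemma. *)
Lemma iter_cart_sum e X Z m (f : 'I_m -> R) :
    (forall x, X x -> exists z : 'I_m -> R, (forall i, Z (z i)) /\
      x = \sum_i f i ^+ (p ^ e) * z i) ->
  forall y, iter e cart X y -> exists z : 'I_m -> R,
    (forall i, iter e cart Z (z i)) /\ y = \sum_i f i * z i.
Proof.
elim: e f => [|e IH] f h y.
  by move=> /h[z [Zz ->]]; exists z; split=> //; under eq_bigr do rewrite expr1.
have /IH{}h : forall x, X x -> exists z : 'I_m -> R, (forall i, Z (z i)) /\
    x = \sum_i (f i ^+ p) ^+ (p ^ e) * z i.
  move=> x /h[z [Zz ->]]; exists z; split=> //.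
  by apply: eq_bigr => i _; rewrite -exprM -expnS.
move=> /= [x [Xx ->]].
have /choice[z zP] i := h _ (Xx i).
exists (fun j => \sum_i fb_coord i (z i j)); split=> [j|].
  by exists (z ^~ j); split=> // i; have [] := zP i.
under [RHS]eq_bigr do rewrite mulr_sumr.
rewrite exchange_big; apply: eq_bigr => i _ /=; rewrite [in LHS](zP i).2 fb_coord_sum.
by apply: eq_bigr => j _; rewrite fb_coordZ.
Qed.

(* The elements of Hom_R(F^e_* R, R). *)
Definition Frob_linear e (f : R -> R) :=
  {morph f : x y / x + y} /\ forall r x, f (r ^+ (p ^ e) * x) = r * f x.

Lemma Frob_linear0 e f : Frob_linear e f -> f 0 = 0.
Proof. by case=> fD _; apply: (addrI (f 0)); rewrite -fD !addr0. Qed.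

Lemma Frob_linear_sum e f (T : Type) (s : seq T) (P : pred T) (F : T -> R) :
  Frob_linear e f -> f (\sum_(j <- s | P j) F j) = \sum_(j <- s | P j) f (F j).
Proof. by move=> fL; apply: (big_morph f fL.1 (Frob_linear0 fL)). Qed.

Lemma iter_Frobenius e r : iter e (pFrobenius_aut charRp) r = r ^+ (p ^ e).
Proof. by elim: e => [|e IH] /=; rewrite ?expr1 // IH pFrobenius_autE -exprM mulnC -expnS. Qed.

Lemma Frob_linearP e (f : R -> R) : Frob_linear e f ->
  exists phi : {linear Frob_push charRp e -> R^o}, phi =1 f.
Proof.
move=> [fD fZ].
have fL : linear (f : Frob_push charRp e -> R^o).
  move=> r x y; rewrite [LHS]fD; congr (_ + _).
  by rewrite [RHS](_ : _ = r * f x) // -fZ -iter_Frobenius.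
pose L := GRing.isLinear.Build R (Frob_push charRp e) R^o *:%R f fL.
pose phi : {linear Frob_push charRp e -> R^o} := HB.pack (f : Frob_push charRp e -> R^o) L.
by exists phi.
Qed.

Lemma linear_Frob e (phi : {linear Frob_push charRp e -> R^o}) : Frob_linear e (phi : R -> R).
Proof.
split=> [x y|r x]; first exact: linearD.
by rewrite -iter_Frobenius; exact: (linearZZ phi).
Qed.

(** Elements of C^e(I) are sums of e-fold composites of coordinates; a map of level e precomposed
    with a coordinate has level e + 1. *)
Lemma iter_cart_min e I J : is_ideal J ->
  (forall f, Frob_linear e f -> forall x, I x -> J (f x)) -> iter e cart I `<=` J.
Proof.
move=> iJ; elim: e I => [|e IH] I h.
  by move=> x Ix; apply: (h id) => //; split=> // r y; rewrite expr1.
rewrite iterSr; apply: IH => f fL _ [x [Ix ->]].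
rewrite (Frob_linear_sum _ _ _ fL); apply: is_ideal_sum => // i _.
apply: (h (f \o fb_coord i)) => //; split=> [y z|r y] /=.
  by rewrite fb_coordD fL.1.
by rewrite expnS mulnC exprM fb_coordZ fL.2.
Qed.

(** After expanding x in the basis, each y |-> f (y^p b_i) is a map of level e, evaluated at a
    coordinate of x, which lies in C(I). *)
Lemma Frob_linear_cart e I f x : is_ideal I -> Frob_linear e f -> I x ->
  iter e cart I (f x).
Proof.
elim: e I f x => [|e IH] I f x iI [fD fZ] Ix.
  by rewrite -[x]mulr1 -[x]expr1 fZ mulrC; apply: is_idealZ.
rewrite [x](fb_coordE B) (@Frob_linear_sum e.+1) //; apply: is_ideal_sum => [|i _].
  by apply: is_ideal_iter_cart.
rewrite iterSr; apply: (IH _ (fun y => f (y ^+ p * fb_elt i))).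
- exact: is_ideal_cart.
- split=> [y z|r y].
    by rewrite -!(pFrobenius_autE charRp) rmorphD mulrDl fD.
  by rewrite -fZ exprMn mulrA -exprM -expnSr.
- by apply: cart_coord => //; apply: is_ideal0.
Qed.

(** Turns the quantification over [phi] in [F_compatible] into a single inclusion of ideals. *)
Lemma linear_image_subP e I J : is_ideal I -> is_ideal J ->
  (forall phi : {linear Frob_push charRp e -> R^o}, phi @` I `<=` J) <->
  iter e cart I `<=` J.
Proof.
move=> iI iJ; split=> [h|h phi _ [x Ix <-]].
  apply: iter_cart_min => // f /Frob_linearP[phi phiE] x Ix.
  by rewrite -phiE; apply: (h phi); exists x.
by apply: h; apply: Frob_linear_cart => //; apply: linear_Frob.
Qed.

End CartierOperators.

(** * Formal power series *)

Module PowerSeriesTheory.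
Import mpoly.

(** * Dickson's lemma for exponent vectors *)

Section Dickson.

(** [a i] is an index, from i on, where v is least on that tail; the subsequence restarts each time
    just past the previous index. *)
Lemma nondecreasing_subseq (v : nat -> nat) : exists2 phi : nat -> nat,
  {homo phi : i j / (i < j)%N} & {homo v \o phi : i j / (i <= j)%N}.
Proof.
have /choice[a aP] : forall i, exists l, (i <= l)%N /\ forall j, (i <= j)%N -> (v l <= v j)%N.
  move=> i; have ex : exists w, `[< exists2 l, (i <= l)%N & v l = w >].
    by exists (v i); apply/asboolP; exists i.
  case: (ex_minnP ex) => w /asboolP[l il <-] lmin; exists l; split=> // j ij.
  by apply: lmin; apply/asboolP; exists j.
pose phi := fix phi i := if i is j.+1 then a (phi j).+1 else a 0%N.
have phiS i : (phi i < phi i.+1)%N by have [] := aP (phi i).+1.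
have phi_lt : {homo phi : i j / (i < j)%N} by apply: homo_ltn => // j i l; apply: ltn_trans.
exists phi => //; apply: homo_leq => // [j i l|i]; first exact: leq_trans.
rewrite /=; case: i => [|i] /=; first by have [_] := aP 0%N; apply.
have [_] := aP (phi i).+1; apply.
have [h _] := aP (a (phi i).+1).+1; apply: leq_trans h.
by have [h _] := aP (phi i).+1; rewrite ltnW // ltnS.
Qed.

Variable n : nat.
Implicit Types m : 'X_{1..n}.

Lemma mnm_good_pair (v : nat -> 'X_{1..n}) : exists i j, (i < j)%N /\ (v i <= v j)%MM.
Proof.
suff [phi phi_lt phi_le] : exists2 phi : nat -> nat, {homo phi : i j / (i < j)%N} &
    forall l : 'I_n, {homo (fun i => v (phi i) l) : i j / (i <= j)%N}.
  exists (phi 0%N), (phi 1%N); split; first exact: phi_lt.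
  by apply/mnm_lepP => l; apply: phi_le.
suff H (s : seq 'I_n) : exists2 phi : nat -> nat, {homo phi : i j / (i < j)%N} &
    forall l : 'I_n, l \in s -> {homo (fun i => v (phi i) l) : i j / (i <= j)%N}.
  by have [phi ? h] := H (enum 'I_n); exists phi => // l; apply: h; rewrite mem_enum.
elim: s => [|l s [phi phi_lt phi_le]]; first by exists id.
have [psi psi_lt psi_le] := nondecreasing_subseq (fun i => v (phi i) l).
exists (phi \o psi) => [i j ij|l' ]; first by apply: phi_lt; apply: psi_lt.
rewrite inE => /predU1P[->|l's] // i j ij; apply: (phi_le l' l's).
by move: ij; rewrite leq_eqVlt => /predU1P[-> //|/psi_lt/ltnW].
Qed.

(** Otherwise elements of A could be chosen greedily, none divisible by an earlier one, against
    [mnm_good_pair]. *)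
Lemma dickson (A : set 'X_{1..n}) : exists s : seq 'X_{1..n},
  (forall m, m \in s -> A m) /\ forall m, A m -> exists2 m', m' \in s & (m' <= m)%MM.
Proof.
apply: contrapT => h.
have /choice[next nextP] : forall s : seq 'X_{1..n}, exists m,
    (forall m, m \in s -> A m) -> A m /\ forall m', m' \in s -> ~~ (m' <= m)%MM.
  move=> s; have [sA|NsA] := pselect (forall m, m \in s -> A m); last by exists 0%MM.
  move/forallNP: h => /(_ s) /not_andP[//|/existsNP[m /not_implyP[Am hm]]].
  exists m => _; split=> // m' m's; apply/negP => m'm; apply: hm; by exists m'.
pose ss := fix ss i := if i is j.+1 then next (ss j) :: ss j else [::].
have ssA i : forall m, m \in ss i -> A m.
  elim: i => [//|i IH] m /=; rewrite inE => /predU1P[->|/IH//].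
  by have [] := nextP _ IH.
have ss_mem i j : (i < j)%N -> next (ss i) \in ss j.
  elim: j => // j IH; rewrite ltnS leq_eqVlt => /predU1P[->|/IH]; rewrite inE ?eqxx //.
  by move=> ->; rewrite orbT.
have [i [j [ij]]] := mnm_good_pair (fun i => next (ss i)).
apply/negP; have [_] := nextP _ (ssA j); apply; exact: ss_mem.
Qed.

End Dickson.

(** * Coefficients and lowest monomials of power series *)

Section Series.
Variables (n : nat) (k : fieldType).
Implicit Types (f g h : mpseries n k) (m u w : 'X_{1..n}).

Lemma mpscoefD f g m : mpscoef (f + g) m = mpscoef f m + mpscoef g m.
Proof. by []. Qed.

Lemma mpscoefN f m : mpscoef (- f) m = - mpscoef f m.
Proof. by []. Qed.

Lemma mpscoef_sum (T : Type) (s : seq T) (P : pred T) (F : T -> mpseries n k) m :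
  mpscoef (\sum_(i <- s | P i) F i) m = \sum_(i <- s | P i) mpscoef (F i) m.
Proof. exact: (big_morph (fun f => mpscoef f m)). Qed.

Lemma mpscoefM_eq0 f g m :
  (forall u w, m = (u + w)%MM -> mpscoef f u * mpscoef g w = 0) -> mpscoef (f * g) m = 0.
Proof. by move=> h; rewrite [LHS]/=; apply: big1 => d /eqP; apply: h. Qed.

Lemma mpscoefM_single f g u w :
  (forall u' w', (u + w = u' + w')%MM -> u' != u -> mpscoef f u' * mpscoef g w' = 0) ->
  mpscoef (f * g) (u + w)%MM = mpscoef f u * mpscoef g w.
Proof.
move=> h; rewrite [LHS]/=.
have ub : (mdeg u < (mdeg (u + w)%MM).+1)%N by rewrite mdegD ltnS leq_addr.
have wb : (mdeg w < (mdeg (u + w)%MM).+1)%N by rewrite mdegD ltnS leq_addl.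
rewrite (bigD1 (BMultinom ub, BMultinom wb)) //= big1 ?addr0 // => -[u' w'] /=.
move=> /andP[/eqP E ne]; apply: h => //; apply: contra ne => /eqP u'E.
move: (E); rewrite u'E => /addmI w'E.
by rewrite xpair_eqE !bmeqP /=; apply/andP; split; apply/eqP.
Qed.

Lemma mpscoefM_congr f f' g m : (forall d, (mdeg d <= mdeg m)%N -> mpscoef f d = mpscoef f' d) ->
  mpscoef (f * g) m = mpscoef (f' * g) m.
Proof.
move=> h; rewrite [LHS]/= [RHS]/=; apply: eq_bigr => -[u w] /= _; rewrite h //.
by have := bmdeg u; rewrite ltnS.
Qed.

Definition mps_monom (c : k) u : mpseries n k := MPSeries (fun m => if m == u then c else 0).

Lemma mpscoef_monomM c u f m : mpscoef (mps_monom c u * f) m =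
  if (u <= m)%MM then c * mpscoef f (m - u)%MM else 0.
Proof.
case: ifPn => [um|Num].
  rewrite -[m in LHS](submK um) addmC mpscoefM_single /=; first by rewrite eqxx.
  by move=> u' w' _ /negbTE ->; rewrite mul0r.
apply: mpscoefM_eq0 => u' w mE /=; case: eqP => [uE|]; last by rewrite mul0r.
by case/negP: Num; rewrite mE uE lem_addr.
Qed.

Definition vanish_below m f := forall u, (u < m)%O -> mpscoef f u = 0.

Lemma initial_monomial f : f <> 0 -> exists2 m, mpscoef f m <> 0 & vanish_below m f.
Proof.
move=> f0; apply: contrapT => h; apply: f0; apply: mpseriesP => m.
elim/(well_founded_ind (@ltom_wf n)): m => m IH.
by apply: contrapT => fm; apply: h; exists m.
Qed.

(** The monomial order is compatible with addition, so at the sum of the two lowest exponents only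
    the product of the lowest coefficients survives. *)
Lemma mpseries_mul_eq0 f g : f * g = 0 -> f = 0 \/ g = 0.
Proof.
move=> fg0; have [|/initial_monomial[u fu vu]] := pselect (f = 0); first by left.
have [|/initial_monomial[w gw vw]] := pselect (g = 0); [by right|exfalso].
have : mpscoef (f * g) (u + w)%MM = mpscoef f u * mpscoef g w.
  apply: mpscoefM_single => u' w' E; rewrite neq_lt => /orP[/vu -> |uu'].
    by rewrite mul0r.
  have [/vw -> |ww'] := ltP w' w; first by rewrite mulr0.
  by have := ltmc_le_add uu' ww'; rewrite E ltxx.
rewrite fg0 => /esym /eqP; rewrite mulf_eq0 => /orP[] /eqP //.
Qed.

(** * Division of power series and noetherianity *)

Section Division.
Variables (r : nat) (g : 'I_r -> mpseries n k) (l : 'I_r -> 'X_{1..n}) (I : set (mpseries n k)).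
Hypotheses (iI : is_ideal I) (gI : forall i, I (g i)).
Hypotheses (lg : forall i, mpscoef (g i) (l i) <> 0) (vg : forall i, vanish_below (l i) (g i)).
Hypothesis cover : forall f m, I f -> mpscoef f m <> 0 -> vanish_below m f ->
  exists i, (l i <= m)%MM.

Let D := \max_i mdeg (l i).

Lemma division_step f : I f -> exists u : 'I_r -> mpseries n k,
  (forall m, vanish_below m f -> mpscoef (f - \sum_i u i * g i) m = 0) /\
  (forall d, (forall m, (mdeg m < d)%N -> mpscoef f m = 0) ->
     forall i m, (mdeg m + D < d)%N -> mpscoef (u i) m = 0).
Proof.
move=> If; have [->|/initial_monomial[m0 fm0 vf]] := pselect (f = 0).
  exists (fun=> 0); split=> // m _; rewrite big1 ?subr0 // => i _; exact: mul0r.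
have [i im0] := cover If fm0 vf; pose c := mpscoef f m0 / mpscoef (g i) (l i).
exists (fun j => if j == i then mps_monom c (m0 - l i)%MM else 0); split.
  have -> : \sum_j (if j == i then mps_monom c (m0 - l i)%MM else 0) * g j =
      mps_monom c (m0 - l i)%MM * g i.
    by rewrite (bigD1 i) //= eqxx big1 ?addr0 // => j /negbTE ->; exact: mul0r.
  move=> m vm; rewrite mpscoefD mpscoefN mpscoef_monomM.
  have mm0 : (m <= m0)%O by rewrite leNgt; apply/negP => /vm.
  move: mm0; rewrite le_eqVlt => /predU1P[->|mm0].
    rewrite lem_subr submBA // addmC addmK /c divfK ?subrr //; exact/eqP.
  rewrite vf //; case: ifPn => [lem|_]; last exact: subrr.
  rewrite (vg (i := i)) ?mulr0 ?subr0 //.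
  rewrite -(ltmc_add2l _ _ (m0 - l i)%MM) submK // addmC [X in (_ < X)%O]addmC.
  by rewrite [X in (_ < X)%O]addmC submK.
move=> d vd j m md; case: eqP => // _ /=; case: eqP => // mE; exfalso; apply: fm0; apply: vd.
rewrite -(submK im0) mdegD -mE (leq_ltn_trans _ md) // leq_add2l.
exact: (leq_bigmax (F := fun i => mdeg (l i))).
Qed.

Lemma division : I `<=` ideal_gen g.
Proof.
have /choice[U UP] : forall f, exists u : 'I_r -> mpseries n k, I f ->
    (forall m, vanish_below m f -> mpscoef (f - \sum_i u i * g i) m = 0) /\
    (forall d, (forall m, (mdeg m < d)%N -> mpscoef f m = 0) ->
      forall i m, (mdeg m + D < d)%N -> mpscoef (u i) m = 0).
  move=> f; have [/division_step[u uP]|NIf] := pselect (I f); first by exists u.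
  by exists (fun=> 0).
move=> f If; pose F := fix F j := if j is j'.+1 then F j' - \sum_i U (F j') i * g i else f.
have IF j : I (F j).
  elim: j => //= j IH; apply: is_idealB => //.
  by apply: is_ideal_sum => // i _; apply: is_idealZ.
(* Counts the monomials of degree below d that precede m. Each step clears one more, so the
   coefficient at m is zero after more than [rk d m] steps. *)
pose rk d m := #|[pred x : 'X_{1..n < d} | (bmnm x < m)%O]|.
have F_rk d j m : (mdeg m < d)%N -> (rk d m < j)%N -> mpscoef (F j) m = 0.
  elim: j m => // j IH m md; rewrite ltnS => rkj.
  have [+ _] := UP _ (IF j); apply => m' m'm.
  have m'd : (mdeg m' < d)%N := leq_ltn_trans (lemc_mdeg (ltW m'm)) md.
  apply: IH => //; apply: leq_trans rkj; apply: proper_card; apply/properP; split.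
    by apply/fintype.subsetP => x; rewrite !inE => /lt_trans; apply.
  by exists (BMultinom m'd); rewrite !inE //= ltxx.
pose N d := #|{: 'X_{1..n < d}}|.+1.
have F_deg d j m : (mdeg m < d)%N -> (N d <= j)%N -> mpscoef (F j) m = 0.
  by move=> md Nj; apply: (F_rk d) => //; apply: leq_trans Nj; rewrite ltnS max_card.
have U_deg j i m : (N (mdeg m + D).+1 <= j)%N -> mpscoef (U (F j) i) m = 0.
  move=> Nj; have [_ h] := UP _ (IF j); apply: (h (mdeg m + D).+1) => // m' m'd.
  exact: F_deg Nj.
have FE b : F b = f - \sum_i (\sum_(j < b) U (F j) i) * g i.
  elim: b => [|b IH].
    by rewrite big1 ?subr0 // => i _; rewrite big_ord0 mul0r.
  rewrite [F b.+1]/= {1}IH -addrA -opprD -big_split; congr (_ - _); apply: eq_bigr => i _.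
  by rewrite big_ord_recr /= mulrDl.
clearbody F N.
(* The sum of all successive quotients: at m, those from this cutoff on contribute nothing. *)
pose h i := MPSeries (fun m => \sum_(j < N (mdeg m + D).+1) mpscoef (U (F j) i) m).
exists h; apply: mpseriesP => m.
(* One index past every threshold relevant to m; the maximum stands in for monotonicity of N. *)
pose b := (\max_(d < (mdeg m + D).+2) N d)%N.
have Nb d : (d < (mdeg m + D).+2)%N -> (N d <= b)%N.
  by move=> dm; apply: (leq_bigmax (F := fun d : 'I__ => N d) (Ordinal dm)).
have /eqP : mpscoef (F b) m = 0 by apply: (F_deg (mdeg m).+1) => //; apply: Nb; rewrite !ltnS leq_addr.
rewrite FE mpscoefD mpscoefN subr_eq0 => /eqP ->; rewrite !mpscoef_sum.
apply: eq_bigr => i _; apply: mpscoefM_congr => d dm; rewrite mpscoef_sum /=.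
have Ndb : (N (mdeg d + D).+1 <= b)%N by apply: Nb; rewrite !ltnS leq_add2r.
rewrite -(subnKC Ndb) big_split_ord /= [X in _ + X]big1 ?addr0 // => j _.
by apply: U_deg; exact: leq_addr.
Qed.

End Division.

(** Dickson's lemma gives finitely many elements whose lowest monomials divide every lowest monomial
    of I; division by them leaves no remainder. *)
Lemma noetherian_mpseries : noetherian (mpseries n k).
Proof.
move=> I iI; pose A : set 'X_{1..n} :=
  [set m | exists f, [/\ I f, mpscoef f m <> 0 & vanish_below m f]].
have [s [sA As]] := dickson A.
have /choice[g gP] : forall i : 'I_(size s), exists f,
    [/\ I f, mpscoef f (tnth (in_tuple s) i) <> 0 & vanish_below (tnth (in_tuple s) i) f].
  by move=> i; apply: sA; apply: mem_tnth.
exists (size s), g; apply/seteqP; split.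
  apply: (@division _ g (tnth (in_tuple s))) => //.
  - by move=> i; have [] := gP i.
  - by move=> i; have [] := gP i.
  - by move=> i; have [] := gP i.
  - move=> f m If fm vf; have [|m' /(@tnthP _ _ (in_tuple s))[i ->] mm'] := As m; first by exists f.
    by exists i.
by apply: ideal_gen_min => // i; have [] := gP i.
Qed.

Lemma mpseries_unit_ideal (I : set (mpseries n k)) f :
  is_ideal I -> I f -> mpscoef f 0%MM <> 0 -> I 1.
Proof.
move=> iI If f0; have [] := @division 1 (fun=> f) (fun=> 0%MM) setT _ _ _ _ _ 1 => //.
- by move=> _ u; rewrite ltNge le0m.
- by move=> h m _ _ _; exists ord0; apply/mnm_lepP => i; rewrite mnm0E.
- by move=> c ->; apply: is_ideal_sum => // i _; apply: is_idealZ.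
Qed.

Lemma mpscoefX b f j m : (mdeg m < b)%N -> mpscoef (f ^+ j) m = (mps_trunc b f ^+ j)@_m.
Proof.
elim: j m => [|j IH] m mb; first by rewrite !expr0 mcoeff1.
rewrite !exprS [LHS](mpscoefM _ _ mb); apply: mcoeffM_eq => // d dm.
by rewrite mcoeff_trunc ?IH // (leq_ltn_trans dm).
Qed.

(** * Frobenius on power series *)

Variables (p : nat) (charkp : p \in [pchar k]).
Let p_gt0 : (0 < p)%N := prime_gt0 (pcharf_prime charkp).
Let charRp := pchar_mpseries n charkp.

Lemma mpscoef_Frobenius f m : mpscoef (f ^+ p) m =
  \sum_(u : 'X_{1..n < (mdeg m).+1}) mpscoef f u ^+ p * ((u *+ p)%MM == m)%:R.
Proof.
have charPp : p \in [pchar {mpoly k[n]}] by apply: (rmorph_pchar (mpolyC n (R := k))).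
rewrite (@mpscoefX (mdeg m).+1) // -(pFrobenius_autE charPp) raddf_sum raddf_sum /=.
apply: eq_bigr => u _; rewrite pFrobenius_autE -mul_mpolyC exprMn mpolyXn -rmorphXn /=.
by rewrite mcoeffCM mcoeffX.
Qed.

Lemma mpscoef_Frobenius_mul f u : mpscoef (f ^+ p) (u *+ p)%MM = mpscoef f u ^+ p.
Proof.
have mulpI : injective (fun u : 'X_{1..n} => (u *+ p)%MM).
  move=> v w /mnmP E; apply/mnmP => i; apply/eqP; rewrite -(eqn_pmul2r p_gt0).
  by have /eqP := E i; rewrite !mulmnE.
have ub : (mdeg u < (mdeg (u *+ p)%MM).+1)%N by rewrite mdegMn ltnS leq_pmulr.
rewrite mpscoef_Frobenius (bigD1 (BMultinom ub)) //= eqxx mulr1 big1 ?addr0 // => v vu.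
case: eqP => [/mulpI vE|_]; last by rewrite mulr0.
by case/eqP: vu; apply/eqP; rewrite bmeqP /= vE.
Qed.

Lemma mpscoef_Frobenius_eq0 f m : (forall u, m <> (u *+ p)%MM) -> mpscoef (f ^+ p) m = 0.
Proof.
move=> h; rewrite mpscoef_Frobenius big1 // => u _.
by case: eqP => [E|_]; [case: (h u)|rewrite mulr0].
Qed.

(** [V d] consists of the series of order at least d. If C^e(cR) were proper, it would lie in [V 1],
    and c would have order at least p^e; this fails when e is the degree of a monomial of c. *)
Lemma mpseries_F_regular (B : Frob_basis (mpseries n k) p) c :
  c <> 0 -> exists e, iter e (cart B) [set r * c | r in setT] 1.
Proof.
move=> c0; pose V d : set (mpseries n k) := [set f | forall m, (mdeg m < d)%N -> mpscoef f m = 0].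
have iV d : is_ideal (V d).
  split=> [//|f g Vf Vg m md|r f Vf m md]; first by rewrite mpscoefD Vf // Vg // addr0.
  apply: mpscoefM_eq0 => u w mE; rewrite Vf ?mulr0 //.
  by apply: leq_ltn_trans md; rewrite mE mdegD leq_addl.
(* f is a combination of p-th powers of its coordinates, and p-th powers multiply orders by p. *)
have cartV d I : is_ideal I -> cart B I `<=` V d -> I `<=` V (p * d)%N.
  move=> iI h f If; rewrite [f](fb_coordE B); apply: is_ideal_sum => // i _.
  rewrite mulrC; apply: (is_idealZ _ (iV _)) => m md.
  have [[u mE]|/forallNP] := pselect (exists u, m = (u *+ p)%MM).
    rewrite mE mpscoef_Frobenius_mul (h (fb_coord i f)) ?expr0n ?gtn_eqF //.
      by apply: cart_coord => //; apply: is_ideal0.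
    by move: md; rewrite mE mdegMn mulnC ltn_pmul2l.
  exact: mpscoef_Frobenius_eq0.
have iterV e I : is_ideal I -> iter e (cart B) I `<=` V 1%N -> I `<=` V (p ^ e)%N.
  elim: e I => [|e IH] I iI; first by rewrite expn0.
  rewrite iterSr expnS => /IH h; apply: cartV => //; apply: h.
  exact: is_ideal_cart.
pose I0 := [set r * c | r in setT]; have iI0 : is_ideal I0.
  split; first by exists 0 => //; rewrite mul0r.
    by move=> _ _ [r _ <-] [s _ <-]; exists (r + s) => //; rewrite mulrDl.
  by move=> s _ [r _ <-]; exists (s * r) => //; rewrite mulrA.
have [m cm _] := initial_monomial c0; exists (mdeg m); apply: contrapT => h.
apply: cm; apply: (iterV (mdeg m) I0) => [//|f If u||].
- rewrite ltnS leqn0 mdeg_eq0 => /eqP ->; apply: contrapT => f0; apply: h.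
  by apply: mpseries_unit_ideal If f0; apply: is_ideal_iter_cart.
- by exists 1; rewrite ?mul1r.
- by rewrite ltn_expl // prime_gt1 // (pcharf_prime charkp).
Qed.

(** A generating family of least size is free: in a nontrivial relation the ratios e_i / e_j enter
    as p-th powers, so b_j could be eliminated. *)
Lemma F_finite_free : F_finite p k -> exists r (b : 'I_r -> k),
  (forall x, exists c : 'I_r -> k, x = \sum_i c i ^+ p * b i) /\
  forall c d : 'I_r -> k, \sum_i c i ^+ p * b i = \sum_i d i ^+ p * b i -> c =1 d.
Proof.
move=> Ffin; pose gen r := `[< exists b : 'I_r -> k,
  forall x, exists c : 'I_r -> k, x = \sum_i c i ^+ p * b i >].
have ex_gen : exists r, gen r by case: Ffin => r [b bP]; exists r; apply/asboolP; exists b.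
case: (ex_minnP ex_gen) => r /asboolP[b bgen] rmin; exists r, b; split=> // c d cd j.
apply/eqP; rewrite -subr_eq0; apply: contraT => ej.
case: r => [|r] in b bgen rmin c d cd j ej *; first by case: j {ej}.
suff /rmin : gen r by rewrite ltnn.
have FB (x y : k) : (x - y) ^+ p = x ^+ p - y ^+ p by rewrite -!(pFrobenius_autE charkp) rmorphB.
have FN (x : k) : (- x) ^+ p = - x ^+ p by rewrite -!(pFrobenius_autE charkp) rmorphN.
pose e i := c i - d i.
have e0 : \sum_i e i ^+ p * b i = 0.
  by under eq_bigr do rewrite FB mulrBl; rewrite sumrB cd subrr.
have bj : b j = \sum_i (- (e (lift j i) / e j)) ^+ p * b (lift j i).
  move: e0; rewrite (bigD1_ord j) //= => /eqP; rewrite addrC addr_eq0 => /eqP e0.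
  have ejp : e j ^+ p != 0 by rewrite expf_neq0.
  apply: (mulfI ejp); rewrite -[LHS]opprK -e0 mulr_sumr -sumrN; apply: eq_bigr => i _.
  by rewrite FN expr_div_n mulrA mulrN mulNr; congr (- (_ * _)); rewrite mulrC divfK.
apply/asboolP; exists (fun i => b (lift j i)) => x; have [a ->] := bgen x.
exists (fun i => a (lift j i) - a j * (e (lift j i) / e j)).
rewrite (bigD1_ord j) //= {1}bj mulr_sumr -big_split /=; apply: eq_bigr => i _.
by rewrite FN FB !exprMn; ring.
Qed.

(** The basis is b_i x^u, with b_i a basis of k over k^p and all exponents of u below p; the
    coordinate at (i, u) reads the coefficients at p v + u. *)
Lemma mpseries_Frob_basis : F_finite p k -> exists B : Frob_basis (mpseries n k) p, True.
Proof.
case/F_finite_free=> r [b [bgen buniq]].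
have /choice[sig sigE] := bgen.
pose idx := ('I_r * {ffun 'I_n -> 'I_p})%type.
pose mm (u : {ffun 'I_n -> 'I_p}) : 'X_{1..n} := [multinom (u i : nat) | i < n].
pose elt (i : idx) : mpseries n k := mps_monom (b i.1) (mm i.2).
pose coord (i : idx) f : mpseries n k := MPSeries (fun v => sig (mpscoef f (v *+ p + mm i.2)%MM) i.1).
have coef_elt (g : idx -> mpseries n k) v (u : {ffun 'I_n -> 'I_p}) :
    mpscoef (\sum_i g i ^+ p * elt i) (v *+ p + mm u)%MM =
    \sum_i mpscoef (g (i, u)) v ^+ p * b i.
  have coef1 i (u' : {ffun 'I_n -> 'I_p}) : mpscoef (g (i, u') ^+ p * elt (i, u')) (v *+ p + mm u)%MM =
      if u' == u then mpscoef (g (i, u)) v ^+ p * b i else 0.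
    rewrite [_ * elt _]mulrC mpscoef_monomM; case: eqP => [->|u'u].
      by rewrite lem_addl addmK mpscoef_Frobenius_mul mulrC.
    case: ifP => // u'le; rewrite mpscoef_Frobenius_eq0 ?mulr0 // => w E.
    apply: u'u; apply/ffunP => l; apply: val_inj.
    have /mnmP/(_ l) : (v *+ p + mm u)%MM = (w *+ p + mm u')%MM by rewrite -E submK.
    rewrite !mnmDE !mulmnE !mnmE => /(congr1 (modn^~ p)).
    by rewrite !modnMDl !modn_small.
  rewrite mpscoef_sum (eq_bigr (fun i : idx =>
    if i.2 == u then mpscoef (g (i.1, u)) v ^+ p * b i.1 else 0)); last first.
    by move=> [i u'] _; rewrite coef1.
  rewrite -(pair_bigA _ (fun i (u' : {ffun 'I_n -> 'I_p}) => if u' == u then mpscoef (g (i, u)) v ^+ p * b i else 0)).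
  by apply: eq_bigr => i _; rewrite -big_mkcond big_pred1_eq.
have decomp m : exists v (u : {ffun 'I_n -> 'I_p}), m = (v *+ p + mm u)%MM.
  exists [multinom (m i %/ p)%N | i < n], [ffun i => Ordinal (ltn_pmod (m i) p_gt0)].
  by apply/mnmP => i; rewrite mnmDE mulmnE !mnmE ffunE /= -divn_eq.
have coordE f : f = \sum_i coord i f ^+ p * elt i.
  apply: mpseriesP => m; have [v [u ->]] := decomp m.
  by rewrite coef_elt; apply: sigE.
(* Uniqueness of expansions makes the chosen coordinates additive and p^{-1}-linear. *)
have uniq (g h : idx -> mpseries n k) : \sum_i g i ^+ p * elt i = \sum_i h i ^+ p * elt i -> g =1 h.
  move=> E [i u]; apply: mpseriesP => v.
  by apply: (buniq (fun i => mpscoef (g (i, u)) v) (fun i => mpscoef (h (i, u)) v)); rewrite -!coef_elt E.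
have coordD i : {morph coord i : x y / x + y}.
  move=> x y; apply: (uniq (coord ^~ (x + y)) (fun i => coord i x + coord i y)).
  rewrite -coordE [in LHS](coordE x) [in LHS](coordE y) -big_split; apply: eq_bigr => j _.
  by rewrite -!(pFrobenius_autE charRp) rmorphD mulrDl.
have coordZ i c x : coord i (c ^+ p * x) = c * coord i x.
  apply: (uniq (coord ^~ (c ^+ p * x)) (fun i => c * coord i x)).
  rewrite -coordE [in LHS](coordE x) mulr_sumr; apply: eq_bigr => j _.
  by rewrite exprMn mulrA.
by exists (FrobBasis coordD coordZ coordE).
Qed.

End Series.
End PowerSeriesTheory.

From mathcomp Require Import all_classical all_reals all_analysis lra zify.
Import numFieldNormedType.Exports.
Local Open Scope classical_set_scope.
Local Open Scope ring_scope.

(** * Test ideals *)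

Section TestIdealsRegular.
Variables (K : realType) (R : comNzRingType) (p : nat) (charRp : p \in [pchar R]).
Variables (B : Frob_basis R p).
Hypothesis nR : noetherian R.
Hypothesis domR : forall x y : R, x * y = 0 -> x = 0 \/ y = 0.
Hypothesis regR : forall c : R, c <> 0 -> exists e, iter e (cart B) [set r * c | r in setT] 1.
Variables (m : nat) (f : 'I_m -> R) (c0 : R).
Let a := ideal_gen f.
Hypotheses (ac0 : a c0) (c0_neq0 : c0 <> 0).
Implicit Types (s t : K) (I J : set R).

Let C := cart B.
Let p_gt0 : (0 < p)%N := prime_gt0 (pcharf_prime charRp).
Let p_gt1 : (1 < p)%N := prime_gt1 (pcharf_prime charRp).
Let ia : is_ideal a := is_ideal_gen f.
Let iexp N : is_ideal (ideal_exp a N) := is_ideal_exp N ia.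

Let pK_gt0 e : 0 < p%:R ^+ e :> K.
Proof. by rewrite exprn_gt0 // ltr0n. Qed.

Definition nat_ceil (t : K) : nat := `|Num.ceil t|%N.

Lemma nat_ceil_le t N : 0 <= t -> (nat_ceil t <= N)%N = (t <= N%:R).
Proof.
move=> t0; rewrite -lez_nat gez0_abs ?ceil_ge0 ?(lt_le_trans _ t0) ?ltrN10 //.
by rewrite -[N%:R]/((N%:Z)%:~R) ceil_le_int.
Qed.

Lemma le_nat_ceil t : 0 <= t -> t <= (nat_ceil t)%:R.
Proof. by move=> t0; rewrite -nat_ceil_le. Qed.

(** With t p^e in place of t (p^e - 1) the ideals increase with e; [test_idealE] recovers the test
    ideal. *)
Definition tau t : set R :=
  [set x | exists e, iter e C (ideal_exp a (nat_ceil (t * p%:R ^+ e))) x].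

(** Put r = p^(d-e). As 1 lies in C^(d-e)(R), x lies in C^(d-e)(x^r R), and x^r is in a^(N r). *)
Lemma tau_step t e d N : 0 <= t -> t * p%:R ^+ e <= N%:R -> (e <= d)%N ->
  iter e C (ideal_exp a N) `<=` iter d C (ideal_exp a (nat_ceil (t * p%:R ^+ d))).
Proof.
move=> t0 tN /subnKC <-; rewrite iterD; apply: iter_cartS => x Nx.
rewrite -[x]mulr1; apply: (@iter_cart_scale _ _ _ _ _ setT) => [y _|].
  rewrite [_ * y]mulrC; apply: is_idealZ => //.
  apply: (@ideal_exp_le _ _ _ (N * p ^ (d - e))) => //; last exact: ideal_expM.
  rewrite nat_ceil_le ?mulr_ge0 ?(ltW (pK_gt0 _)) // exprD mulrA natrM natrX.
  by rewrite ler_wpM2r // ltW.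
by have /(_ 1 I) := @sub_iter_cart _ _ charRp B _ _ _ (@is_idealT R) (leq0n (d - e)).
Qed.

Let tp_ge0 t e : 0 <= t -> 0 <= t * p%:R ^+ e.
Proof. by move=> t0; rewrite mulr_ge0 // ltW. Qed.

Lemma tau_attained t : 0 <= t -> exists e, forall d, (e <= d)%N ->
  tau t = iter d C (ideal_exp a (nat_ceil (t * p%:R ^+ d))).
Proof.
move=> t0; pose I_ d := iter d C (ideal_exp a (nat_ceil (t * p%:R ^+ d))).
have mI d d' : (d <= d')%N -> I_ d `<=` I_ d'.
  by move=> dd; apply: tau_step => //; apply: le_nat_ceil; apply: tp_ge0.
have [|d|e eP] := @noetherian_acc _ I_ nR.
- by move=> d; apply: is_ideal_iter_cart.
- exact: mI.
exists e => d /eP Id; rewrite -/(I_ d) Id; apply/seteqP; split=> x; last by exists e.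
move=> [d' Ix]; have /eP <- := leq_maxl e d'; apply: mI Ix; exact: leq_maxr.
Qed.

Lemma is_ideal_tau t : 0 <= t -> is_ideal (tau t).
Proof. by move=> /tau_attained[e /(_ e (leqnn _)) ->]; apply: is_ideal_iter_cart. Qed.

Lemma tau_anti s t : 0 <= s -> s <= t -> tau t `<=` tau s.
Proof.
move=> s0 st x [e xe]; exists e; apply: tau_step xe => //.
have t0 := le_trans s0 st.
by apply: le_trans (le_nat_ceil (tp_ge0 e t0)); rewrite ler_wpM2r // ltW.
Qed.

(** If 1 is in C^d(c0 R), then C^e(a^N) lies in C^(e+d)(a^(N p^d + 1)); the extra factor c0 leaves
    room 1/p^(e+d) above t. *)
Lemma tau_right_constant t : 0 <= t ->
  exists2 dlt, 0 < dlt & forall s, t <= s < t + dlt -> tau s = tau t.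
Proof.
move=> t0; have [e /(_ e (leqnn _)) te] := tau_attained t0.
have [d d1] := regR c0_neq0; pose N := nat_ceil (t * p%:R ^+ e).
exists (p%:R ^+ (e + d))^-1; first by rewrite invr_gt0.
move=> s /andP[ts st]; have s0 := le_trans t0 ts.
apply/seteqP; split; first exact: tau_anti.
rewrite te -/N => x xN; exists (e + d)%N.
apply: (@tau_step _ (e + d) _ (N * p ^ d + 1)) => //.
  rewrite natrD natrM natrX.
  have : s * p%:R ^+ (e + d) <= (t + (p%:R ^+ (e + d))^-1) * p%:R ^+ (e + d).
    by rewrite ler_wpM2r ?ltW.
  move/le_trans; apply; rewrite mulrDl mulVf ?gt_eqF // lerD2r exprD mulrA.
  by apply: ler_wpM2r; [exact: ltW|apply: le_nat_ceil; apply: tp_ge0].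
rewrite iterD; move: x xN; apply: iter_cartS => y Ny; rewrite -[y]mulr1.
apply: (iter_cart_scale _ d1) => _ [r _ <-]; rewrite mulrCA; apply: is_idealZ => //.
apply: ideal_expD => //; first exact: ideal_expM.
by rewrite -[c0]expr1; apply: ideal_expX.
Qed.

Lemma iter_cart_tau t e : 0 <= t -> iter e C (tau t) = tau (t / p%:R ^+ e).
Proof.
move=> t0; have tp0 : 0 <= t / p%:R ^+ e by rewrite divr_ge0 // ltW.
have [d1 /(_ (maxn d1 _) (leq_maxl _ _)) td1] := tau_attained t0.
have [d2 td2] := tau_attained tp0.
rewrite (td1 d2) -iterD (td2 (e + maxn d1 d2)%N); last first.
  by rewrite (leq_trans (leq_maxr d1 d2)) ?leq_addl.
by rewrite exprD mulrA divfK // gt_eqF.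
Qed.

(** Let q = p^d. From m <= t follows N >= m q, so the pigeonhole lemma puts a^N in the sum of the
    f_i^q a^(N-q), and C^d pulls out the f_i. *)
Lemma skoda t : m%:R <= t -> 1 <= t -> tau t = ideal_mul a (tau (t - 1)).
Proof.
move=> mt t1; have t0 : 0 <= t by rewrite (le_trans _ t1).
have t10 : 0 <= t - 1 by rewrite subr_ge0.
have [d1 /(_ (maxn d1 _) (leq_maxl _ _)) td1] := tau_attained t0.
have [d2 /(_ (maxn d1 d2) (leq_maxr _ _)) td2] := tau_attained t10.
rewrite (td1 d2) td2; set d := maxn d1 d2; set N := nat_ceil (t * _).
have tN : t * p%:R ^+ d <= N%:R by rewrite le_nat_ceil // tp_ge0.
have qN : (p ^ d <= N)%N.
  by rewrite -(ler_nat K) natrX (le_trans _ tN) // ler_peMl // ltW.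
(* p^d is an integer, so rounding up commutes with subtracting it. *)
have -> : nat_ceil ((t - 1) * p%:R ^+ d) = (N - p ^ d)%N.
  apply/eqP; rewrite eqn_leq nat_ceil_le ?tp_ge0 // natrB // natrX mulrBl mul1r.
  rewrite lerD2r tN leq_subLR nat_ceil_le ?tp_ge0 // natrD natrX.
  by rewrite -lerBlDl -[X in _ - X]mul1r -mulrBl le_nat_ceil // tp_ge0.
apply/seteqP; split.
  move=> x; have iK : is_ideal (ideal_mul a (iter d C (ideal_exp a (N - p ^ d)))).
    exact: is_ideal_mul.
  case/(@iter_cart_sum _ _ _ _ _ (ideal_exp a (N - p ^ d)) m f) => [y|z [Iz ->]].
    apply: ideal_exp_pigeonhole.
    have [m0|m_gt0] := posnP m; first by rewrite {1}m0 mul0n (leq_trans _ qN) // expn_gt0 p_gt0.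
    apply: (@leq_trans (m * p ^ d)); first by rewrite ltn_pmul2l // ltn_predL expn_gt0 p_gt0.
    rewrite -(ler_nat K) natrM natrX; apply: le_trans tN.
    by apply: ler_wpM2r => //; exact: ltW.
  by apply: is_ideal_sum => // i _; apply: ideal_mulW => //; apply: ideal_gen_mem.
apply: ideal_mul_min => [|x y ax]; first exact: is_ideal_iter_cart.
apply: iter_cart_scale => z Iz; rewrite -(subnKC qN); apply: ideal_expD => //.
exact: ideal_expX.
Qed.

Lemma skoda_iter t N : m%:R <= t -> tau (t + N%:R) = iter N (ideal_mul a) (tau t).
Proof.
move=> mt; have t0 : 0 <= t by apply: le_trans mt.
elim: N => [|N IH]; first by rewrite addr0.
rewrite skoda.
- by rewrite -natr1 addrA addrK IH.
- by rewrite (le_trans mt) // lerDl.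
- by rewrite -natr1 addrA lerDr addr_ge0.
Qed.

Lemma tau_left_constant t e N : m%:R < t -> (0 < e)%N -> t * (p%:R ^+ e - 1) = N%:R ->
  exists s0, [/\ m%:R <= s0, s0 < t & forall s, s0 <= s < t -> tau s = tau s0].
Proof.
move=> mt e0 tN; pose q : K := p%:R ^+ e; have q0 : 0 < q := pK_gt0 e.
have qX i : 0 < q ^+ i by apply: exprn_gt0.
(* The iterates of s |-> (s + N) / q from m, with fixed point t; none drops below m, so Skoda's
   theorem applies to all. *)
pose s_ i := t - (t - m%:R) / q ^+ i.
have q1 : 1 < q by rewrite exprn_egt1 ?ltr1n // -?lt0n.
have ms i : m%:R <= s_ i.
  rewrite lerBrDl -lerBrDr ler_pdivrMr ?qX //.
  by apply: ler_peMr; [rewrite subr_ge0 ltW|rewrite exprn_ege1 // ltW].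
have s0 i : 0 <= s_ i := le_trans (ler0n K m) (ms i).
have st i : s_ i < t by rewrite ltrBlDr ltrDl divr_gt0 ?qX // subr_gt0.
have sS i : s_ i.+1 = (s_ i + N%:R) / q.
  rewrite /s_ -tN -/q exprS; field.
  by rewrite !gt_eqF ?qX.
have s_le i j : (i <= j)%N -> s_ i <= s_ j.
  move=> ij; rewrite lerD2l lerN2 ler_wpM2l ?subr_ge0 ?(ltW mt) //.
  by rewrite lef_pV2 ?posrE ?qX // ler_weXn2l // ltW.
pose Phi I := iter e C (iter N (ideal_mul a) I).
have [|||i|i|i|i iP] := @chain_stabilizes _ Phi (p ^ e) (fun i => tau (s_ i)) nR.
- by rewrite -(ltr_nat K) natrX.
- by move=> I J IJ; apply: iter_cartS; apply: iter_ideal_mulS.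
- move=> g I J IJ; apply: iter_cart_scale; exact: iter_ideal_mul_scale.
- exact: is_ideal_tau.
- by rewrite sS -iter_cart_tau; [rewrite skoda_iter|apply: addr_ge0].
- by apply: tau_anti => //; apply: s_le.
exists (s_ i); split=> // s /andP[sis st'].
(* The gap t - s_j is (t - m) / q^j, so s_j eventually overtakes s. *)
have [j ij sj] : exists2 j, (i <= j)%N & s <= s_ j.
  have [j] : exists j, (t - m%:R) / (t - s) <= q ^+ j.
    exists (Num.bound ((t - m%:R) / (t - s))).
    apply: le_trans (ltW (upper_nthrootP (leqnn _))) _.
    by rewrite lerXn2r ?nnegrE ?(ltW q0) // /q -natrX ler_nat (leq_trans p_gt1) // -{1}(expn1 p) leq_pexp2l.
  exists (maxn i j); first exact: leq_maxl.
  apply: le_trans (s_le _ _ (leq_maxr i j)); rewrite lerBrDl -lerBrDr.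
  by rewrite ler_pdivrMr ?qX // mulrC -ler_pdivrMr // subr_gt0.
apply/seteqP; split; first exact: tau_anti.
by rewrite -(iP j ij); apply: tau_anti => //; exact: (le_trans (s0 i)).
Qed.

(** Nonzero, as it contains a power of c0; compatible, as ceil(t (p^d - 1)) p^e + ceil(t p^e) >= t
    p^(d+e). *)
Lemma tau_candidate t : 0 <= t -> candidate charRp a t (tau t).
Proof.
move=> t0; have [e /(_ e (leqnn _)) te] := tau_attained t0.
split; first exact: is_ideal_tau.
  move=> t_eq0; set N := nat_ceil _ in te.
  have c0N : c0 ^+ N <> 0.
    by elim: N {te} => [|N IH]; [apply/eqP/oner_neq0|rewrite exprS => /domR[]].
  apply: c0N; suff : tau t (c0 ^+ N) by rewrite t_eq0.
  rewrite te; apply: (@sub_iter_cart _ _ charRp B 0 e) => //.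
  exact: ideal_expX.
move=> d d0; apply/linear_image_subP => //; first exact: is_ideal_mul.
  exact: is_ideal_tau.
set M := ceil_exp p t d; set N := nat_ceil _ in te.
have tM : t * (p%:R ^+ d - 1) <= M%:R.
  by apply: le_nat_ceil; rewrite mulr_ge0 // subr_ge0 exprn_ege1 // ler1n.
apply: (@subset_trans _ (iter (d + e) C (ideal_exp a (M * p ^ e + N)))).
  rewrite iterD; apply: iter_cartS; rewrite te; apply: ideal_mul_min => [|x y Mx].
    exact: is_ideal_iter_cart.
  by apply: iter_cart_scale => z Nz; apply: ideal_expD => //; apply: ideal_expM.
move=> x xM; exists (d + e)%N; apply: tau_step xM => //.
rewrite natrD natrM natrX exprD.
have tp : t * p%:R ^+ e <= N%:R by apply: le_nat_ceil; apply: tp_ge0.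
have -> : t * (p%:R ^+ d * p%:R ^+ e) = t * (p%:R ^+ d - 1) * p%:R ^+ e + t * p%:R ^+ e by ring.
by rewrite lerD // ler_wpM2r // ltW.
Qed.

(** Take c <> 0 in J with 1 in C^(d+1)(cR). Then C^e(a^N) lies in C^(e+d+1)(a^M J) for M = ceil(t
    (p^(e+d+1) - 1)), because M <= N p^(d+1). *)
Lemma tau_min t J : 0 <= t -> candidate charRp a t J -> tau t `<=` J.
Proof.
move=> t0 [iJ J0 cJ].
have [c [Jc /regR[d d1]]] : exists c, J c /\ c <> 0.
  apply: contrapT => /forallNP h; apply: J0; apply/seteqP; split=> [c Jc|_ ->].
    by apply: contrapT => c0'; apply: (h c).
  exact: is_ideal0.
(* One more application of C makes e + d + 1 positive, as [F_compatible] asks. *)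
have {}d1 : iter d.+1 C [set r * c | r in setT] 1.
  apply: sub_iter_cart d1 => //; split.
  - by exists 0 => //; rewrite mul0r.
  - by move=> _ _ [r _ <-] [r' _ <-]; exists (r + r') => //; rewrite mulrDl.
  - by move=> s _ [r _ <-]; exists (s * r) => //; rewrite mulrA.
move=> x [e xe]; set N := nat_ceil _ in xe.
have eJ : iter (e + d.+1) C (ideal_mul (ideal_exp a (ceil_exp p t (e + d.+1))) J) `<=` J.
  by apply/(linear_image_subP charRp) => //; [apply: is_ideal_mul|apply: cJ; rewrite addnS].
apply: eJ; rewrite iterD; move: x xe; apply: iter_cartS => y Ny; rewrite -[y]mulr1.
apply: (iter_cart_scale _ d1) => _ [r _ <-]; apply: ideal_mulW; last exact: is_idealZ.
have NM : ideal_exp a (N * p ^ d.+1) (y ^+ (p ^ d.+1)) by apply: ideal_expM.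
apply: ideal_exp_le NM => //; rewrite /ceil_exp -/(nat_ceil _) nat_ceil_le; last first.
  by rewrite mulr_ge0 // subr_ge0 exprn_ege1 // ler1n.
rewrite natrM natrX exprD mulrBr mulr1 mulrA lerBlDr.
apply: (@le_trans _ _ (N%:R * p%:R ^+ d.+1)); last by rewrite lerDl.
by apply: ler_wpM2r; [exact: ltW|apply: le_nat_ceil; apply: tp_ge0].
Qed.

Lemma test_idealE t : 0 <= t -> test_ideal charRp a t = tau t.
Proof.
move=> t0; apply: xget_unique.
  by split=> [|J]; [apply: tau_candidate|apply: tau_min].
move=> J [cJ minJ]; apply/seteqP; split; first by apply: minJ; apply: tau_candidate.
exact: tau_min.
Qed.

(** * Jumping numbers expressed through [tau] *)

Let jump := F_jumping_number charRp a : set K.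

Lemma jump_tau_neq s t : 0 <= s -> s < t -> jump t -> tau s <> tau t.
Proof.
move=> s0 st [t0 /(_ (t - s))]; rewrite subr_gt0 opprB addrC subrK.
by rewrite !test_idealE ?(ltW t0) //; apply.
Qed.

Lemma jumpP t : 0 < t -> (forall s, 0 <= s < t -> tau s <> tau t) -> jump t.
Proof.
move=> t0 h; split=> // eps eps0 teps; rewrite !test_idealE ?(ltW t0) //.
by apply: h; rewrite teps ltrBlDr ltrDl.
Qed.

Lemma jump_right_isolated t : 0 <= t ->
  exists2 dlt, 0 < dlt & forall s, t < s < t + dlt -> ~ jump s.
Proof.
move=> t0; have [dlt dlt0 dltP] := tau_right_constant t0; exists dlt => // s /andP[ts st].
by move/(jump_tau_neq t0 ts); apply; rewrite dltP // (ltW ts).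
Qed.

(** Applying C to tau(s) = tau(p t) would give tau(s/p) = tau(t). *)
Lemma jumpM t : jump t -> jump (p%:R * t).
Proof.
move=> jt; have t0 : 0 < t := jt.1; apply: jumpP; first by rewrite mulr_gt0 // ltr0n.
move=> s /andP[s0 st] /(congr1 C).
have tauC u : 0 <= u -> C (tau u) = tau (u / p%:R).
  by move=> u0; apply: (iter_cart_tau 1 u0).
rewrite !tauC // ?mulr_ge0 ?(ltW t0) // [p%:R * t]mulrC mulfK ?pnatr_eq0 -?lt0n //.
apply: jump_tau_neq jt; first by rewrite divr_ge0.
by rewrite ltr_pdivrMr ?ltr0n // mulrC.
Qed.

(** Skoda's theorem carries tau(v) = tau(t - 1) to tau(v + 1) = tau(t); the bound m + 1 < t leaves
    room to raise s to some v >= m. *)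
Lemma jumpB1 t : m.+1%:R < t -> jump t -> jump (t - 1).
Proof.
rewrite -natr1 => mt jt; have m0 : 0 <= m%:R :> K by [].
apply: jumpP => [|s /andP[s0 st] tau_s]; first by lra.
have [v [sv mv vt]] : exists v, [/\ s <= v, m%:R <= v & v < t - 1].
  by exists (Num.max s m%:R); rewrite !le_max !lexx orbT gt_max st; split=> //; lra.
have tau_v : tau v = tau (t - 1).
  apply/seteqP; split; last by apply: tau_anti; lra.
  by rewrite -tau_s; apply: tau_anti.
have tau_v1 : tau (v + 1) = tau t.
  by rewrite (@skoda (v + 1)) ?(@skoda t) ?addrK ?tau_v //; lra.
by move: tau_v1; apply: jump_tau_neq jt; lra.
Qed.

Lemma jump_left_isolated t e N : m%:R < t -> (0 < e)%N -> t * (p%:R ^+ e - 1) = N%:R ->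
  exists2 s0, s0 < t & forall s, s0 < s < t -> ~ jump s.
Proof.
move=> mt e0 tN; have [s0 [ms0 s0t s0P]] := tau_left_constant mt e0 tN.
exists s0 => // s /andP[s0s st]; have m0 : 0 <= m%:R :> K by [].
move/(jump_tau_neq (le_trans m0 ms0) s0s); apply.
by rewrite s0P // st ltW.
Qed.

End TestIdealsRegular.

(** * Jumping numbers *)

Section ExpandingMap.
Variables (K : realType) (p m : nat) (J : set K).
Hypothesis p_gt1 : (1 < p)%N.
Hypothesis J_gt0 : forall t, J t -> 0 < t.
Hypothesis J_right : forall t, 0 <= t ->
  exists2 dlt, 0 < dlt & forall s, t < s < t + dlt -> ~ J s.
Hypothesis JM : forall t, J t -> J (p%:R * t).
Hypothesis JB1 : forall t, m.+1%:R < t -> J t -> J (t - 1).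
Hypothesis J_left : forall t e N, m%:R < t -> (0 < e)%N ->
  t * (p%:R ^+ e - 1) = N%:R -> exists2 s0, s0 < t & forall s, s0 < s < t -> ~ J s.
Implicit Types (x y s t : K).

Let m0 : 0 <= m%:R :> K. Proof. by []. Qed.
Let p1 : 1 < p%:R :> K. Proof. by rewrite ltr1n. Qed.

(* Multiplication by p modulo 1 on the fundamental domain ]m, m + 1]. *)
Definition ptwist x : K := p%:R * x - (Num.ceil (p%:R * x))%:~R + m.+1%:R.

Lemma ptwist_bounds x : m%:R < ptwist x <= m.+1%:R.
Proof.
have /andP[] := ceil_itv (p%:R * x); rewrite /ptwist -natr1 intrD.
by move=> ? ?; apply/andP; split; lra.
Qed.

Lemma pmul_gt x : m%:R < x -> x < p%:R * x.
Proof. by move=> mx; rewrite ltr_pMl // (le_lt_trans m0). Qed.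

Lemma expand_gt x : 0 < x -> exists k, m%:R < p%:R ^+ k * x.
Proof.
move=> x0; exists (Num.bound (m%:R / x)); rewrite -ltr_pdivrMr //.
apply: lt_le_trans (upper_nthrootP (leqnn _)) _.
by rewrite lerXn2r ?nnegrE // ler_nat.
Qed.

(** p x exceeds m, so its ceiling is at least m + 1 and the shift is a repeated subtraction of 1. *)
Lemma ptwist_shift x : m%:R < x -> exists N : nat, ptwist x = p%:R * x - N%:R.
Proof.
move=> mx; have mpx : m%:R < p%:R * x := lt_trans mx (pmul_gt mx).
have : 0 <= Num.ceil (p%:R * x) - m.+1%:Z.
  by rewrite subr_ge0 -addn1 PoszD lezD1 ceil_gt_int.
case NE: (Num.ceil _ - _) => [N|//] _.
by exists N; rewrite /ptwist -(subrK m.+1%:Z (Num.ceil _)) NE intrD opprD addrA subrK.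
Qed.

(** The ceiling is constant just to the left of a point, endpoint included; this suits a domain
    closed on the right. *)
Lemma ptwist_left x : exists2 dlt, 0 < dlt &
  forall y, x - dlt < y <= x -> ptwist y = ptwist x - p%:R * (x - y).
Proof.
have p0 : 0 < p%:R :> K by apply: lt_trans p1.
have /andP[c1 c2] := ceil_itv (p%:R * x); set c := Num.ceil _ in c1 c2.
exists ((p%:R * x - (c - 1)%:~R) / p%:R); first by rewrite divr_gt0 // subr_gt0.
move=> y /andP[xy yx]; rewrite /ptwist -/c (@ceil_def _ _ c); first by lra.
apply/andP; split; last by apply: le_trans c2; rewrite ler_pM2l.
move: xy; rewrite ltrBlDr -ltrBlDl ltr_pdivlMr // => ?; lra.
Qed.

Lemma iter_ptwist_bounds e x : m%:R < x <= m.+1%:R -> m%:R < iter e ptwist x <= m.+1%:R.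
Proof. by case: e => //= e _; apply: ptwist_bounds. Qed.

Lemma iter_ptwist_shift e x : m%:R < x ->
  exists N : nat, iter e ptwist x = p%:R ^+ e * x - N%:R.
Proof.
move=> mx; elim: e => [|e [N IH]]; first by exists 0%N; rewrite expr0 mul1r subr0.
have me : m%:R < iter e ptwist x by case: e {IH} => //= e; case/andP: (ptwist_bounds (iter e ptwist x)).
rewrite /=; have [N' ->] := ptwist_shift me; exists (p * N + N')%N.
by rewrite IH mulrBr mulrA -exprS natrD natrM opprD addrA.
Qed.

Lemma iter_ptwist_left e x : exists2 dlt, 0 < dlt &
  forall y, x - dlt < y <= x -> iter e ptwist y = iter e ptwist x - p%:R ^+ e * (x - y).
Proof.
have p0 d : 0 < p%:R ^+ d :> K by apply: exprn_gt0; apply: lt_trans p1.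
elim: e => [|e [dlt dlt0 IH]].
  by exists 1 => // y _; rewrite /= expr0 mul1r opprB addrC subrK.
have [dlt' dlt'0 h] := ptwist_left (iter e ptwist x).
exists (Num.min dlt (dlt' / p%:R ^+ e)); first by rewrite lt_min dlt0 divr_gt0.
move=> y; rewrite ltrBlDr -ltrBlDl lt_min => /andP[/andP[xy1]].
rewrite ltr_pdivlMr // => xy2 yx.
have IHy : iter e ptwist y = iter e ptwist x - p%:R ^+ e * (x - y).
  by apply: IH; rewrite yx ltrBlDr -ltrBlDl xy1.
rewrite [in LHS]/= IHy h; first by rewrite opprB addrCA subrr addr0 exprS mulrA.
by rewrite ltrD2l ltrN2 mulrC xy2 gerBl mulr_ge0 ?subr_ge0 // ltW.
Qed.

Lemma J_sub_nat N y : J y -> m%:R < y - N%:R -> J (y - N%:R).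
Proof.
elim: N y => [|N IH] y Jy; first by rewrite subr0.
have -> : y - N.+1%:R = y - 1 - N%:R by rewrite -natr1; lra.
have N0 : 0 <= N%:R :> K by [].
by move=> my; apply: IH => //; apply: JB1 => //; rewrite -natr1; lra.
Qed.

Lemma J_ptwist x : m%:R < x -> J x -> J (ptwist x).
Proof.
move=> mx Jx; have [N NE] := ptwist_shift mx; rewrite NE.
by apply: J_sub_nat; [apply: JM|rewrite -NE; case/andP: (ptwist_bounds x)].
Qed.

Definition left_acc x := forall dlt, 0 < dlt -> exists2 s, J s & x - dlt < s < x.

Lemma left_accM x : left_acc x -> left_acc (p%:R * x).
Proof.
have p0 : 0 < p%:R :> K by apply: lt_trans p1.
move=> ax dlt dlt0; have [|s Js /andP[s1 s2]] := ax (dlt / p%:R); first by rewrite divr_gt0.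
exists (p%:R * s); first exact: JM.
rewrite ltr_pM2l // s2 andbT ltrBlDr -ltrBlDl -mulrBr mulrC -ltr_pdivlMr //.
by rewrite ltrBlDl -ltrBlDr.
Qed.

Lemma left_acc_ptwist x : m%:R < x -> left_acc x -> left_acc (ptwist x).
Proof.
have p0 : 0 < p%:R :> K by apply: lt_trans p1.
move=> mx ax dlt dlt0; have [d1 d10 d1P] := ptwist_left x.
have [|s Js] := ax (Num.min (x - m%:R) (Num.min d1 (dlt / p%:R))).
  by rewrite !lt_min subr_gt0 mx d10 divr_gt0.
rewrite ltrBlDr -ltrBlDl !lt_min ltr_pdivlMr // => /andP[/and3P[xs1 xs2 xs3] sx].
exists (ptwist s); first by apply: J_ptwist => //; lra.
rewrite (d1P s); last by apply/andP; split; lra.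
by rewrite ltrD2l ltrN2 mulrC xs3 ltrBlDr ltrDl mulr_gt0 // subr_gt0.
Qed.

Let L : set K := [set x | m%:R < x <= m.+1%:R /\ left_acc x].

Let L_iter e x : L x -> L (iter e ptwist x).
Proof.
move=> Lx; elim: e => //= e [me ae]; split; first exact: ptwist_bounds.
by apply: left_acc_ptwist => //; case/andP: me.
Qed.

(* J has no accumulation from the right, so it is well-ordered, and so is L. *)
Let L_min (S : set K) : S `<=` L -> S !=set0 -> exists2 y, S y & forall z, S z -> y <= z.
Proof.
move=> SL S0; have lbS : lbound S m%:R by move=> y /SL[/andP[/ltW]].
have hlS : has_lbound S by exists m%:R.
have [|dlt dlt0 dltP] := @J_right (inf S).
  exact: le_trans m0 (lb_le_inf S0 lbS).
have [y Sy yS] := inf_adherent dlt0 (conj S0 hlS).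
exists (inf S); last by move=> z; apply: ge_inf.
have := ge_inf hlS Sy; rewrite le_eqVlt => /predU1P[-> //|Sy'].
(* A point of S just above its infimum is a left limit of J, which puts elements of J just to the
   right of the infimum. *)
have [_ /(_ (y - inf S))[|s Js]] := SL _ Sy; first by rewrite subr_gt0.
rewrite opprB addrC subrK => /andP[s1 s2]; exfalso.
by apply: (dltP s) => //; rewrite s1 (lt_trans s2).
Qed.

Let orbit_min x : L x -> exists e, forall d, iter e ptwist x <= iter d ptwist x.
Proof.
move=> Lx; have [||y [e _ ye] ymin] := @L_min [set iter e ptwist x | e in setT].
- by move=> _ [e _ <-]; apply: L_iter.
- by exists x, 0%N.
by exists e => d; rewrite ye; apply: ymin; exists d.
Qed.

(* Take the largest element of L that is minimal in its own orbit: it lies in the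
   orbit of its image, hence is periodic, which J_left excludes. *)
Let L_empty x : ~ L x.
Proof.
move=> Lx; pose Y := [set y | L y /\ forall e, y <= iter e ptwist y].
have Y0 : Y !=set0.
  have [e ey] := orbit_min Lx; exists (iter e ptwist x); split=> [|d].
    exact: L_iter.
  by rewrite -iterD.
have ubY : ubound Y m.+1%:R by move=> y [[/andP[]]].
have hY : has_sup Y by split=> //; exists m.+1%:R.
pose s := sup Y; have Ys : Y s.
  have [//|NYs] := pselect (Y s).
  have Y_lt y : Y y -> y < s.
    move=> Yy; rewrite lt_neqAle (ub_le_sup hY.2) // andbT.
    by apply/eqP => ys; apply: NYs; rewrite -ys.
  split; first split.
  - have [y Yy] := Y0; rewrite (lt_trans _ (Y_lt y Yy)); last by case: Yy => [[/andP[]]].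
    exact: ge_sup.
  - move=> dlt dlt0; have [y Yy sy] := sup_adherent dlt0 hY.
    have [|t Jt] := Yy.1.2 (y - (s - dlt)); first by rewrite subr_gt0.
    rewrite opprB addrC subrK => /andP[t1 t2].
    by exists t => //; rewrite t1 (lt_trans t2) // Y_lt.
  (* With T = [ptwist], y <= T^e y = T^e s - p^e (s - y) and s - y <= p^e (s - y) give s <= T^e
     s. *)
  - move=> e; have [dlt dlt0 dltP] := iter_ptwist_left e s.
    have [y Yy sy] := sup_adherent dlt0 hY; have ys := Y_lt y Yy.
    have := Yy.2 e; rewrite dltP; last by rewrite sy ltW.
    have : s - y <= p%:R ^+ e * (s - y).
      by rewrite ler_peMl ?subr_ge0 ?(ltW ys) // exprn_ege1 // ltW.
    by move=> ? ?; lra.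
(* The minimum of the orbit of T s belongs to Y, so it is at most s; it is at least s because s is
   minimal in its own orbit. *)
have [e emin] := orbit_min (L_iter 1 Ys.1).
have Ye : Y (iter e.+1 ptwist s).
  by rewrite iterSr; split=> [|d]; [exact: (L_iter e (L_iter 1 Ys.1))|rewrite -iterD].
have sE : iter e.+1 ptwist s = s.
  by apply/eqP; rewrite eq_le (ub_le_sup hY.2 Ye) Ys.2.
have [/andP[ms _] acc_s] := Ys.1.
have [N] := iter_ptwist_shift e.+1 ms; rewrite sE => sN.
have [||s0 s0s s0P] := @J_left s e.+1 N ms => //; first by lra.
have [|t Jt] := acc_s (s - s0); first by rewrite subr_gt0.
by rewrite opprB addrC subrK => /s0P.
Qed.

Lemma no_left_acc x : ~ left_acc x.
Proof.
move=> ax; have x0 : 0 < x.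
  by have [//|s Js /andP[_]] := ax 1; apply: lt_trans; apply: J_gt0.
have [k mk] := expand_gt x0.
have akx : left_acc (p%:R ^+ k * x).
  elim: k {mk} => [|k IH]; first by rewrite expr0 mul1r.
  by rewrite exprS -mulrA; apply: left_accM.
apply: (@L_empty (ptwist (p%:R ^+ k * x))); split; first exact: ptwist_bounds.
exact: left_acc_ptwist.
Qed.

Lemma J_isolated t : exists2 dlt, 0 < dlt & forall s, `|t - s| < dlt -> s != t -> ~ J s.
Proof.
have [t0|t0] := ltP t 0.
  exists (- t); first by rewrite oppr_gt0.
  by move=> s; rewrite ltr_norml => /andP[s1 s2] _ /J_gt0 ?; lra.
have [d1 d10 d1P] := J_right t0.
have /existsNP[d2 /not_implyP[d20 d2P]] := no_left_acc (x := t).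
exists (Num.min d1 d2); first by rewrite lt_min d10.
move=> s; rewrite lt_min !ltr_norml => /andP[/andP[s1 s2] /andP[s3 s4]].
rewrite neq_lt => /orP[st|ts] Js.
  by apply: d2P; exists s => //; apply/andP; split; lra.
by apply: (d1P s) => //; apply/andP; split; lra.
Qed.

Lemma J_limit_point : limit_point (J : set K) = set0.
Proof.
rewrite -subset0 => t lt_t; have [dlt dlt0 dltP] := J_isolated t.
have [|s [st Js ts]] := lt_t (ball t dlt); first exact: nbhsx_ballx.
exact: (dltP s).
Qed.

Let rational_affine (x y : K) (A N : nat) : (0 < A)%N ->
  A%:R * x - N%:R = y -> @rational K y -> @rational K x.
Proof.
move=> A0 <- [q _ qE]; exists ((q + N%:R) / A%:R) => //.
by rewrite fmorph_div rmorphD /= !ratr_nat qE subrK [A%:R * x]mulrC mulfK // pnatr_eq0 -lt0n.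
Qed.

Lemma J_rational : J `<=` @rational K.
Proof.
move=> x Jx; have x0 := J_gt0 Jx.
have [k mk] := expand_gt x0.
have Jk : J (p%:R ^+ k * x).
  elim: k {mk} => [|k IH]; first by rewrite expr0 mul1r.
  by rewrite exprS -mulrA; apply: JM.
pose y := ptwist (p%:R ^+ k * x); have yb : m%:R < y <= m.+1%:R := ptwist_bounds _.
pose z i := iter i ptwist y; have zb i : m%:R < z i <= m.+1%:R by apply: iter_ptwist_bounds.
have Jz i : J (z i).
  elim: i => [|i IH]; first exact: J_ptwist.
  by apply: J_ptwist => //; case/andP: (zb i).
(* An injective orbit would be an infinite bounded subset of J, with a limit point by
   Bolzano-Weierstrass. *)
have [i [d [d0 zid]]] : exists i d, (0 < d)%N /\ z (i + d)%N = z i.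
  apply: contrapT => h; have zI : injective z.
    suff zI i d : z (i + d)%N = z i -> d = 0%N.
      move=> i j zij; have [ij|ji] := leqP i j.
        by have := zI i (j - i)%N; rewrite subnKC // => /(_ (esym zij)) ?; lia.
      by have := zI j (i - j)%N; rewrite subnKC ?(ltnW ji) // => /(_ zij) ?; lia.
    by case: d => // d zid; exfalso; apply: h; exists i, d.+1.
  have zinf : infinite_set (range z).
    move=> fz; apply: infinite_nat.
    have := @finite_preimage _ _ _ z (in2W zI) fz.
    by rewrite preimage_range.
  have bz : bounded_set (range z).
    exists m.+1%:R; split=> // M Mm _ [i _ <-]; have /andP[z1 z2] := zb i.
    by rewrite /= ger0_norm ?(le_trans z2) ?ltW // (le_lt_trans m0).
  have [t lt_t] := infinite_bounded_limit_point_nonempty zinf bz.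
  suff : limit_point (J : set K) t by rewrite J_limit_point.
  by move=> U /lt_t[s [st [i _ zs] Us]]; exists s; split; rewrite // -zs.
have /andP[mz _] := zb i.
have [N NE] := iter_ptwist_shift d mz.
have [N' NE'] := iter_ptwist_shift i (proj1 (andP yb)).
have [N'' NE''] := ptwist_shift mk.
have pd : (1 < p ^ d)%N by rewrite -(exp1n d) ltn_exp2r.
(* Integer affine relations lead from x to y, from y to [z i], and from [z i] to 0, the last being
   (p^d - 1) z_i - N = 0 by periodicity. *)
apply: (@rational_affine _ y (p ^ k.+1) N'').
- by rewrite expn_gt0 (ltnW p_gt1).
- by rewrite /y NE'' natrX exprS mulrA.
apply: (@rational_affine _ (z i) (p ^ i) N').
- by rewrite expn_gt0 (ltnW p_gt1).
- by rewrite -/(z i) natrX in NE' *.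
apply: (@rational_affine _ 0 (p ^ d - 1) N); first by rewrite subn_gt0.
  move: NE; rewrite -iterD addnC -/(z _) zid natrB ?(ltnW pd) // natrX; lra.
by exists 0 => //; rewrite raddf0.
Qed.

End ExpandingMap.

(** For positive s and e the exponent is positive, so the product ideal is zero and every nonzero
    ideal is a candidate; hence t / 2 and t have the same candidates. *)
Lemma zero_ideal_no_jump (K : realType) (R : comNzRingType) (p : nat)
  (charRp : p \in [pchar R]) (a : set R) (t : K) :
  (forall x, a x -> x = 0) -> ~ F_jumping_number charRp a t.
Proof.
move=> a0 [t0 /(_ (t / 2))]; rewrite divr_gt0 // => /(_ isT).
have tE : t - t / 2 = t / 2 by lra.
rewrite tE divr_ge0 ?ltW // => /(_ isT); apply.
have p1 : (1 < p)%N := prime_gt1 (pcharf_prime charRp).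
have compat s J : 0 < s -> is_ideal J -> F_compatible charRp a s J.
  move=> s0 iJ e e0 phi _ [x [m [u [v [au _ ->]]]] <-].
  have u0 i : u i = 0.
    have : (0 < ceil_exp p s e)%N.
      rewrite absz_gt0 gt_eqF // ceil_gt0 mulr_gt0 // subr_gt0.
      by rewrite exprn_egt1 ?ltr1n // -lt0n.
    case: ceil_exp au => // N au _; have [m' [u' [v' [au' _ ->]]]] := au i.
    by rewrite big1 // => j _; rewrite (a0 _ (au' j)) mul0r.
  rewrite big1 ?linear0; first exact: is_ideal0.
  by move=> i _; rewrite u0 mul0r.
have sub s s' : 0 < s -> 0 < s' -> candidate charRp a s `<=` candidate charRp a s'.
  by move=> s0 s'0 J [iJ J0 _]; split=> //; apply: compat.
have t20 : 0 < t / 2 by rewrite divr_gt0.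
suff cE : candidate charRp a (t / 2) = candidate charRp a t.
  by rewrite /test_ideal /is_test_ideal cE.
by apply/seteqP; split; apply: sub.
Qed.

Theorem corollary6p4 (K : realType) (k : fieldType) (p n : nat)
    (charkp : p \in [pchar k]) (Ffin : F_finite p k)
    (a : set (mpseries n k)) (ideal_a : is_ideal a) :
  F_jumping_number (pchar_mpseries n charkp) a `<=` @rational K /\
  limit_point (F_jumping_number (pchar_mpseries n charkp) a : set K) = set0.
Proof.
(* The description by [tau] rests on a nonzero element of the ideal, so the zero ideal is treated
   apart. *)
have [[c0 [ac0 c0_neq0]]|/forallNP a0] := pselect (exists c, a c /\ c <> 0); last first.
  have noJ t : ~ F_jumping_number (K := K) (pchar_mpseries n charkp) a t.
    by apply: zero_ideal_no_jump => x ax; apply: contrapT => x0; apply: (a0 x).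
  split=> [t /noJ //|]; rewrite -subset0 => t /(_ setT)[|s [_ /noJ]] //.
  exact: filterT.
have [B _] := PowerSeriesTheory.mpseries_Frob_basis n charkp Ffin.
have nR := @PowerSeriesTheory.noetherian_mpseries n k.
have domR := @PowerSeriesTheory.mpseries_mul_eq0 n k.
have regR := PowerSeriesTheory.mpseries_F_regular charkp B.
have [m [f aE]] := nR a ideal_a; move: ac0; rewrite {a ideal_a}aE => ac0.
have p1 : (1 < p)%N := prime_gt1 (pcharf_prime charkp).
pose charRp := pchar_mpseries n charkp.
pose J : set K := F_jumping_number charRp (ideal_gen f).
have J_gt0 t : J t -> 0 < t by case.
have JR := @jump_right_isolated K _ _ charRp B nR domR regR m f c0 ac0 c0_neq0.
have JM := @jumpM K _ _ charRp B nR domR regR m f c0 ac0 c0_neq0.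
have JB1 := @jumpB1 K _ _ charRp B nR domR regR m f c0 ac0 c0_neq0.
have JL := @jump_left_isolated K _ _ charRp B nR domR regR m f c0 ac0 c0_neq0.
by split; [apply: J_rational p1 J_gt0 JR JM JB1 JL|apply: J_limit_point p1 J_gt0 JR JM JB1 JL].
Qed.
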